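(* With the notation below, let $p\in\mathcal P^{(\boldsymbol\alpha)}(\mathbf m)$ be a path of soliton content $\mathbf m=(m_1,\dots,m_N)$ (all $m_j>0$) and symmetry $\boldsymbol\alpha$. Then there is a bijection between the orbit $\mathcal T\cdot p\subset\mathcal P$ and the discrete torus $F^{(\boldsymbol\alpha)}\mathbb Z^N\backslash\mathbb Z^N$ which commutes with the action of $\mathcal T$, where $\sum_kn_kT_k$ acts on $F^{(\boldsymbol\alpha)}\mathbb Z^N\backslash\mathbb Z^N$ by $[\boldsymbol\omega]\mapsto[\boldsymbol\omega+\sum_kn_k\boldsymbol h_k]$ with $\boldsymbol h_k=(\min(j,k))_{1\le j\le N}$.
   Context: Paths: fix $L\ge1$; $\mathcal P$ is the set of words $b_1\cdots b_L$ in letters $1,2$ with $\#1\ge\#2$. $B_k$ ($k\ge1$) is the set of words $1^{k-a}2^a$, $0\le a\le k$. The map $R:B_k\times B_1\to B_1\times B_k$ is: $R(1^k,1)=(1,1^k)$; $R(2^k,2)=(2,2^k)$; $R(1^{k-a}2^a,1)=(2,1^{k-a+1}2^{a-1})$ for $0<a\le k$; $R(1^{k-a}2^a,2)=(1,1^{k-a-1}2^{a+1})$ for $0\le a<k$. For $v\in B_k$ and a path $b_1\cdots b_L$, set $v_0=v$ and $(b'_i,v_i)=R(v_{i-1},b_i)$ for $i=1,\dots,L$. Let $v^*$ be the final $v_L$ obtained starting from $v=1^k$; running again from $v=v^*$ one returns $v_L=v^*$, and one defines $T_k(b_1\cdots b_L)=b'_1\cdots b'_L$ computed from $v=v^*$.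 ($T_1$ is the cyclic shift $b_1\cdots b_L\mapsto b_Lb_1\cdots b_{L-1}$.) The $T_k$ commute and are bijections of $\mathcal P$; $\mathcal T$ is the free abelian group on $T_1,\dots,T_N$ acting on $\mathcal P$ via $\sum n_kT_k\mapsto T_1^{n_1}\cdots T_N^{n_N}$. Ballot sequences: $p_+=b_1\cdots b_L$ is ballot if every prefix has at least as many $1$'s as $2$'s; every $p\in\mathcal P$ equals $T_1^d(p_+)$ for some $d\in\mathbb Z$ and ballot $p_+$. KKR map of a ballot $p_+$: with $b_{L+1}:=1$, let $M_1$ (resp. $M_2$) be the multiset of $j\in\{1,\dots,L\}$ with $b_j=1,b_{j+1}=2$ (resp. $b_j=2,b_{j+1}=1$). $\mathrm{Op}_1$ (resp. $\mathrm{Op}_2$) replaces the $i$-th smallest element $x$ of a multiset (counting multiplicity) by $x-(2i-1)$ (resp. $x-2i$), for all $i$. Repeat until $M_1=M_2=\varnothing$: set $i=0$; while $M_1\cap M_2=\varnothing$ apply $\mathrm{Op}_1$ to $M_1$, $\mathrm{Op}_2$ to $M_2$ and increase $i$ by $1$; then record $(S,i)$ with $S=M_1\cap M_2$ (multiset intersection) and remove $S$ from both. The records $(S_1,i_1),\dots,(S_s,i_s)$ give $j_a=i_1+\dots+i_a$, $m_{j_a}=|S_a|$, and riggings $(J^{(j_a)}_i)_{1\le i\le m_{j_a}}$ = elements of $S_a$ in increasing order. The path $p=T_1^d(p_+)$ has soliton content $\mathbf m=(m_1,\dots,m_N)$ if $\{j_1,\dots,j_s\}=\{1,\dots,N\}$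 with these multiplicities (this is independent of the decomposition). Vacancy numbers $p_j=L-2\sum_k\min(j,k)m_k$; $B_{j,k}=2\min(j,k)$. For $m\ge1,q\ge0$: $\overline{\mathcal J}(m,q)=\{(J_i)_{i\in\mathbb Z}:J_i\in\mathbb Z, J_i\le J_{i+1}, J_{i+m}=J_i+q\}$; for a positive common divisor $\alpha$ of $m,q$ (every positive integer divides $0$), $\overline{\mathcal J}^{(\alpha)}(m,q)=\{J\in\overline{\mathcal J}(m/\alpha,q/\alpha):J\notin\overline{\mathcal J}(m/\alpha',q/\alpha')$ for all common divisors $\alpha'>\alpha\}$. Extend riggings quasi-periodically by $J^{(j)}_{i+m_j}=J^{(j)}_i+p_j$ and add $d$ to all entries. For $\boldsymbol\alpha=(\alpha_j)$, $\alpha_j$ a positive common divisor of $m_j,p_j$, $p$ has symmetry $\boldsymbol\alpha$ (written $p\in\mathcal P^{(\boldsymbol\alpha)}(\mathbf m)$) if the resulting sequence $(J^{(j)}_i+d)_{i,j}$ lies in $\prod_j\overline{\mathcal J}^{(\alpha_j)}(m_j,p_j)$ (this is independent of the decomposition $p=T_1^d(p_+)$). Finally $F^{(\boldsymbol\alpha)}_{j,k}=(\delta_{j,k}p_k+B_{j,k}m_k)/\alpha_k$. *)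

(* Defs.v *)
From HB Require Import structures.
From mathcomp Require Import all_boot all_order all_algebra.
Set Implicit Arguments. Unset Strict Implicit. Unset Printing Implicit Defensive.
Import Order.TTheory GRing.Theory Num.Theory.
Local Open Scope ring_scope.

Definition inP (L : nat) (p : seq nat) : bool :=
  [&& size p == L, all (fun b => (b == 1%N) || (b == 2%N)) p
    & (count (pred1 2%N) p <= count (pred1 1%N) p)%N].

(* Element 1^(k-a) 2^a of B_k is encoded by a (number of 2's). *)
Definition Rmap (k a b : nat) : nat * nat :=
  if b == 1%N then (if a == 0%N then (1%N, 0%N) else (2%N, a.-1))
  else (if a == k then (2%N, k) else (1%N, a.+1)).

Fixpoint run (k a : nat) (p : seq nat) : seq nat * nat :=
  match p with
  | [::] => ([::], a)
  | b :: p' => let ba := Rmap k a b in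
               let r := run k ba.2 p' in (ba.1 :: r.1, r.2)
  end.

Definition Tk (k : nat) (p : seq nat) : seq nat := (run k (run k 0 p).2 p).1.

Definition letter (b : bool) : nat := if b then 2%N else 1%N.

Definition Tinv (k : nat) (q : seq nat) : seq nat :=
  if [pick t : (size q).-tuple bool |
        inP (size q) (map letter t) && (Tk k (map letter t) == q)] is Some t
  then map letter t else q.

Definition Tpow (k : nat) (z : int) (p : seq nat) : seq nat :=
  match z with
  | Posz n => iter n (Tk k) p
  | Negz n => iter n.+1 (Tinv k) p
  end.

(* Action of sum_k n_k T_k (k = 1..N; index i : 'I_N stands for k = i+1). *)
Definition act (N : nat) (n : 'cV[int]_N) (p : seq nat) : seq nat :=
  foldr (fun (i : 'I_N) acc => Tpow i.+1 (n i 0) acc) p (enum 'I_N).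

Definition path_orbit (N : nat) (p q : seq nat) : Prop := exists n : 'cV[int]_N, act n p = q.

Definition ballot (p : seq nat) : Prop :=
  forall i, (i <= size p)%N ->
    (count (pred1 2%N) (take i p) <= count (pred1 1%N) (take i p))%N.

Definition sortZ (s : seq int) : seq int := sort (fun x y : int => x <= y) s.

Definition Op1 (s : seq int) : seq int :=
  let t := sortZ s in [seq nth 0 t i - (2 * i + 1)%:Z | i <- iota 0 (size t)].
Definition Op2 (s : seq int) : seq int :=
  let t := sortZ s in [seq nth 0 t i - (2 * i.+1)%:Z | i <- iota 0 (size t)].

Fixpoint minter (s t : seq int) : seq int :=
  match s with
  | [::] => [::]
  | x :: s' => if x \in t then x :: minter s' (rem x t) else minter s' t
  end.
Definition mdiff (s S : seq int) : seq int := foldr (fun x acc => rem x acc) s S.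

Fixpoint inner (fuel : nat) (M1 M2 : seq int) (i : nat)
  : option (seq int * seq int * nat) :=
  if minter M1 M2 != [::] then Some (M1, M2, i) else
  match fuel with
  | 0 => None
  | f.+1 => inner f (Op1 M1) (Op2 M2) i.+1
  end.

Fixpoint outer (fuel : nat) (M1 M2 : seq int) : option (seq (seq int * nat)) :=
  if (M1 == [::]) && (M2 == [::]) then Some [::] else
  match fuel with
  | 0 => None
  | f.+1 =>
    match inner f M1 M2 0 with
    | None => None
    | Some (M1', M2', i) =>
        let S := minter M1' M2' in
        match outer f (mdiff M1' S) (mdiff M2' S) with
        | None => None
        | Some r => Some ((S, i) :: r)
        end
    end
  end.

Definition Mset (x y : nat) (p : seq nat) : seq int :=
  let p' := p ++ [:: 1%N] in
  [seq (Posz j) | j <- iota 1 (size p) &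
     (nth 0%N p' j.-1 == x) && (nth 0%N p' j == y)].

Definition kkr_records (p : seq nat) (recs : seq (seq int * nat)) : Prop :=
  exists fuel, outer fuel (Mset 1 2 p) (Mset 2 1 p) = Some recs.

(* {j_1,...,j_s} = {1,...,N} with m_{j_a} = |S_a| *)
Definition has_content (N : nat) (m : nat -> nat) (recs : seq (seq int * nat)) : Prop :=
  scanl (fun acc r => (acc + r.2)%N) 0%N recs = iota 1 N /\
  forall a, (a < N)%N -> size (nth ([::], 0%N) recs a).1 = m a.+1.

Definition rigging (recs : seq (seq int * nat)) (j : nat) : seq int :=
  sortZ (nth ([::], 0%N) recs j.-1).1.

Definition vac (L N : nat) (m : nat -> nat) (j : nat) : int :=
  L%:Z - 2 * (\sum_(1 <= k < N.+1) (minn j k * m k)%N)%:Z.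

(* quasi-periodic extension J_{i+mj} = J_i + pj, with J = (J_1,...,J_mj) *)
Definition ext (J : seq int) (mj : nat) (pj : int) (i : int) : int :=
  nth 0 J (absz ((i - 1) %% mj)%Z) + ((i - 1) %/ mj)%Z * pj.

Definition Jbar (m q : int) (J : int -> int) : Prop :=
  (forall i, J i <= J (i + 1)) /\ (forall i, J (i + m) = J i + q).

Definition Jbar_alpha (m q : int) (a : nat) (J : int -> int) : Prop :=
  Jbar (m %/ a)%Z (q %/ a)%Z J /\
  forall a' : nat, (a < a')%N -> (a'%:Z %| m)%Z -> (a'%:Z %| q)%Z ->
    ~ Jbar (m %/ a')%Z (q %/ a')%Z J.

Definition has_symmetry (L N : nat) (m alpha : nat -> nat) (p : seq nat) : Prop :=
  inP L p /\
  (forall j, (1 <= j <= N)%N ->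
     [/\ (0 < alpha j)%N, (alpha j %| m j)%N & ((alpha j)%:Z %| vac L N m j)%Z]) /\
  exists (d : int) (pplus : seq nat) (recs : seq (seq int * nat)),
    [/\ p = Tpow 1 d pplus, inP L pplus, ballot pplus,
        kkr_records pplus recs /\ has_content N m recs &
        forall j, (1 <= j <= N)%N ->
          Jbar_alpha (m j)%:Z (vac L N m j) (alpha j)
            (fun i => ext (rigging recs j) (m j) (vac L N m j) i + d)].

Definition Fmat (L N : nat) (m alpha : nat -> nat) : 'M[int]_N :=
  \matrix_(j < N, k < N)
    (((if j == k then vac L N m k.+1 else 0) + 2 * (minn j.+1 k.+1 * m k.+1)%N%:Z)
       %/ (alpha k.+1)%:Z)%Z.

Definition torus_eq (N : nat) (F : 'M[int]_N) (w w' : 'cV[int]_N) : Prop :=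
  exists v : 'cV[int]_N, w - w' = F *m v.

Definition hvec (N : nat) (k : 'I_N) : 'cV[int]_N := \col_(j < N) (minn j.+1 k.+1)%:Z.

Definition tshift (N : nat) (n : 'cV[int]_N) : 'cV[int]_N := \sum_(k < N) n k 0 *: hvec k.

(* Main.v *)
Require Import Defs.
From HB Require Import structures.
From mathcomp Require Import all_boot all_order all_algebra.
From mathcomp Require Import zify ring.
From Stdlib Require Import ClassicalEpsilon.
Import GRing.Theory.
Import Order.TTheory Num.Theory.
Set Implicit Arguments. Unset Strict Implicit. Unset Printing Implicit Defensive.
Local Open Scope ring_scope.

(** Read a path as an [L]-periodic word on [int] and record the positions [X i] of its 12-cuts and
    [Y i] of its 21-cuts.  On these bi-infinite sequences one KKR step subtracts [2 i - 1] from [X i]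
    and [2 i] from [Y i] and then splits off the common cuts, i.e. the riggings of that level, without
    changing the underlying word; counting functions of cuts turn this splitting into an addition.
    Hence the riggings determine the path, and two quasi-periodic families of riggings give the same
    path exactly when they differ by a renumbering of the cuts at each level.

    If the carrier of capacity [k] has loads [A i] and [B i] at the ends of the runs of 2's and 1's,
    then after a KKR step the loads [A i - 1] and [B i] are those of a carrier of capacity [k - 1], and
    the evolved cuts move by one further unit.  By induction [T_k] adds [min(j, k)] to the riggings of
    level [j].  So an element of the lattice fixes [p] iff the induced translation of the riggings is
    a renumbering; by maximality of [alpha] these translations are the columns of [Fmat]. *)

(** * Interlaced cut sequences and towers of riggings *)

Lemma int_ind_up (P : int -> Prop) (t0 : int) :
  P t0 -> (forall t : int, t0 <= t -> P t -> P (t + 1)) -> forall t : int, t0 <= t -> P t.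
Proof.
move=> P0 PS t le_t; have -> : t = t0 + (absz (t - t0))%:Z by lia.
elim: (absz (t - t0)) => [|n IHn]; first by rewrite addr0.
have -> : t0 + n.+1%:Z = (t0 + n) + 1 by lia.
by apply: PS => //; lia.
Qed.

Lemma int_ind_down (P : int -> Prop) (t0 : int) :
  P t0 -> (forall t : int, t < t0 -> P (t + 1) -> P t) -> forall t : int, t <= t0 -> P t.
Proof.
move=> P0 PS t le_t; have -> : t = t0 - (absz (t0 - t))%:Z by lia.
elim: (absz (t0 - t)) => [|n IHn]; first by rewrite subr0.
apply: PS; first lia.
by have -> : t0 - n.+1%:Z + 1 = t0 - n%:Z by lia.
Qed.

Lemma int_const (T : Type) (f : int -> T) :
  (forall t : int, f (t + 1) = f t) -> forall t : int, f t = f 0.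
Proof.
move=> Hf t; have [le0|/ltW le0] := leP 0 t.
  by apply: (int_ind_up (P := fun t => f t = f 0)) le0 => // u _ <-.
by apply: (int_ind_down (P := fun t => f t = f 0)) le0 => // u _ <-.
Qed.

(** A Galois connection: [c t] is the largest index [i] with [X i <= t]. Each of [X] and [c]
    determines the other, and merging two sequences amounts to adding their [c]. *)
Definition gal (X c : int -> int) := forall i t : int, (X i <= t) = (i <= c t).

Lemma gal_le X c (i : int) : gal X c -> i <= c (X i).
Proof. by move=> g; rewrite -g. Qed.

Lemma gal_count_nondecr X c : gal X c -> forall s t : int, s <= t -> c s <= c t.
Proof. by move=> g s t le_st; rewrite -g (le_trans _ le_st) // g. Qed.

Lemma gal_unique_seq X X' c c' : c =1 c' -> gal X c -> gal X' c' -> X =1 X'.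
Proof.
move=> E g g' i; have H t : (X i <= t) = (X' i <= t) by rewrite g g' E.
have := H (X i); have := H (X' i); lia.
Qed.

Lemma gal_unique_count X X' c c' : X =1 X' -> gal X c -> gal X' c' -> c =1 c'.
Proof.
move=> E g g' t; have H i : (i <= c t) = (i <= c' t) by rewrite -g -g' E.
have := H (c t); have := H (c' t); lia.
Qed.

Lemma gal_ext X X' c c' : X =1 X' -> c =1 c' -> gal X c -> gal X' c'.
Proof. by move=> E E' g i t; rewrite -E -E' g. Qed.

Lemma gal_shift X c (s d : int) : gal X c ->
  gal (fun i : int => X (i + s) + d) (fun t : int => c (t - d) - s).
Proof. by move=> g i t; have := g (i + s) (t - d); lia. Qed.

Lemma gal_jump X c (t : int) : gal X c -> c (t - 1) < c t -> X (c t) = t.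
Proof. by move=> g; have := g (c t) (t - 1); have := g (c t) t; lia. Qed.

(** The weak form allows runs of length zero, which appear after a KKR step before the common cuts
    are split off; the cuts of a word satisfy the strict form [sweave]. *)
Definition weave (X Y : int -> int) := forall i : int, X i <= Y i /\ Y i <= X (i + 1).
Definition sweave (X Y : int -> int) := forall i : int, X i < Y i /\ Y i < X (i + 1).

Lemma sweave_weave X Y : sweave X Y -> weave X Y.
Proof. by move=> S i; have := S i; lia. Qed.

Lemma weave_count X Y cX cY : gal X cX -> gal Y cY -> weave X Y ->
  forall t : int, cY t <= cX t /\ cX t <= cY t + 1.
Proof.
move=> gX gY W t; split.
  by rewrite -gX; apply: le_trans (W _).1 _; rewrite gY.
suff : cX t - 1 <= cY t by lia.
rewrite -gY; apply: le_trans (W _).2 _.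
have -> : cX t - 1 + 1 = cX t by lia.
by rewrite gX.
Qed.

Lemma count_weave X Y cX cY : gal X cX -> gal Y cY ->
  (forall t : int, cY t <= cX t /\ cX t <= cY t + 1) -> weave X Y.
Proof.
move=> gX gY W i; split.
  by rewrite gX; apply: le_trans (W _).1; rewrite -gY.
by rewrite gY; have := (W (X (i + 1))).2; have := gal_le (i + 1) gX; lia.
Qed.

(* [J j] are the riggings of the solitons of length [j + 1], and there are [r + 1] lengths. *)
Fixpoint tower (r : nat) (J : nat -> int -> int) (X Y : int -> int) : Prop :=
  match r with
  | 0 => [/\ forall i : int, J 0%N i <= J 0%N (i + 1),
             forall i : int, X i = J 0%N i + (2 * i - 1)
           & forall i : int, Y i = J 0%N i + 2 * i]
  | r'.+1 => exists X' Y' cX cY cJ,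
      [/\ tower r' (fun j => J j.+1) X' Y',
          [/\ gal (J 0%N) cJ, gal X' cX & gal Y' cY],
          gal (fun i : int => X i - (2 * i - 1)) (fun t : int => cX t + cJ t)
        & gal (fun i : int => Y i - 2 * i) (fun t : int => cY t + cJ t)]
  end.

Lemma tower_ext r J J' X X' Y Y' :
  (forall j, (j <= r)%N -> J j =1 J' j) -> X =1 X' -> Y =1 Y' ->
  tower r J X Y -> tower r J' X' Y'.
Proof.
elim: r J J' X X' Y Y' => [|r IHr] J J' X X' Y Y' EJ EX EY /=.
  by case=> M HX HY; split=> i; rewrite -?EJ -?EX -?EY.
case=> U [V [cX [cY [cJ [T [gJ gU gV] gX gY]]]]].
exists U, V, cX, cY, cJ; split=> //.
- by apply: IHr T => // j le_j; apply: EJ.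
- by split=> //; apply: gal_ext gJ => //; apply: EJ.
- by apply: gal_ext gX => // i; rewrite EX.
- by apply: gal_ext gY => // i; rewrite EY.
Qed.

(** Adding [cJ] to both counts preserves their difference, so the reduced sequences interlace
    weakly; restoring [2 * i - 1] and [2 * i] lengthens every run by one and makes this strict. *)
Lemma tower_sweave r J X Y : tower r J X Y -> sweave X Y.
Proof.
elim: r J X Y => [|r IHr] J X Y /=.
  by case=> M HX HY i; rewrite !HX !HY; have := M i; lia.
case=> U [V [cX [cY [cJ [T [gJ gU gV] gX gY]]]]].
have W := weave_count gU gV (sweave_weave (IHr _ _ _ T)).
have {}W : weave (fun i : int => X i - (2 * i - 1)) (fun i : int => Y i - 2 * i).
  by apply: (count_weave gX gY) => t; have := W t; lia.
by move=> i; have := W i; lia.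
Qed.

Lemma tower_unique r J X X' Y Y' :
  tower r J X Y -> tower r J X' Y' -> X =1 X' /\ Y =1 Y'.
Proof.
elim: r J X X' Y Y' => [|r IHr] J X X' Y Y' /=.
  by case=> _ HX HY [_ HX' HY']; split=> i; rewrite ?HX ?HX' ?HY ?HY'.
case=> U [V [cX [cY [cJ [T [gJ gU gV] gX gY]]]]].
case=> U' [V' [cX' [cY' [cJ' [T' [gJ' gU' gV'] gX' gY']]]]].
have [EU EV] := IHr _ _ _ _ _ T T'.
have EJ := gal_unique_count (fun=> erefl) gJ gJ'.
have EcX := gal_unique_count EU gU gU'; have EcY := gal_unique_count EV gV gV'.
have EX : forall i : int, X i - (2 * i - 1) = X' i - (2 * i - 1).
  by apply: gal_unique_seq gX gX' => t; rewrite EcX EJ.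
have EY : forall i : int, Y i - 2 * i = Y' i - 2 * i.
  by apply: gal_unique_seq gY gY' => t; rewrite EcY EJ.
by split=> i; [have := EX i | have := EY i]; lia.
Qed.

(* Renumbering the cuts by [s j] before the [j]-th KKR step. *)
Definition slide (s : nat -> int) (d : int) (J : nat -> int -> int) (j : nat) (i : int) : int :=
  J j (i + s j - s j.+1) + d + 2 * \sum_(l < j.+1) s l.

Lemma slide0 (s : nat -> int) (d : int) J i : slide s d J 0 i = J 0%N (i + s 0%N - s 1%N) + d + 2 * s 0%N.
Proof. by rewrite /slide big_ord1. Qed.

Lemma slideS (s : nat -> int) (d : int) J j (i : int) : slide s d J j.+1 i =
  slide (fun j => s j.+1) (d + 2 * s 0%N) (fun j => J j.+1) j i.
Proof.
by rewrite /slide big_ord_recl /= !mulrDr -!addrA.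
Qed.

(** Reindexing by [s 0] turns the subtraction of [2 * i] into a displacement [2 * s 0] of all that
    remains after the step, and the riggings absorb the index change [s 0 - s 1]. No cuts survive
    the last level, whence [s r.+1 = 0]. *)
Lemma tower_slide r (s : nat -> int) (d : int) J X Y : s r.+1 = 0 -> tower r J X Y ->
  tower r (slide s d J) (fun i : int => X (i + s 0%N) + d) (fun i : int => Y (i + s 0%N) + d).
Proof.
elim: r s d J X Y => [|r IHr] s d J X Y sr /=.
  case=> M HX HY; split=> i; rewrite !slide0 sr !subr0.
  - have := M (i + s 0%N); have -> : i + s 0%N + 1 = i + 1 + s 0%N by lia.
    by lia.
  - by rewrite HX; lia.
  - by rewrite HY; lia.
case=> U [V [cX [cY [cJ [T [gJ gU gV] gX gY]]]]].
pose e := d + 2 * s 0%N.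
exists (fun i : int => U (i + s 1%N) + e), (fun i : int => V (i + s 1%N) + e).
exists (fun t : int => cX (t - e) - s 1%N), (fun t : int => cY (t - e) - s 1%N).
exists (fun t : int => cJ (t - e) - (s 0%N - s 1%N)); split.
- by apply: tower_ext (IHr (fun j => s j.+1) e _ _ _ sr T) => // j _ i; rewrite slideS.
- split; try exact: gal_shift.
  apply: gal_ext (gal_shift (s 0%N - s 1%N) e gJ) => // i.
  by rewrite slide0 /e !addrA.
- apply: gal_ext (gal_shift (s 0%N) e gX) => [i|t] /=; rewrite /e; lia.
- apply: gal_ext (gal_shift (s 0%N) e gY) => [i|t] /=; rewrite /e; lia.
Qed.

(** By strictness every 21-cut shows as a drop of the difference of counts from 1 to 0, so [cY] and
    [cY'] have equal increments and differ by a constant. *)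
Lemma sweave_word_unique X Y X' Y' cX cY cX' cY' :
  gal X cX -> gal Y cY -> gal X' cX' -> gal Y' cY' -> sweave X Y -> sweave X' Y' ->
  (forall t : int, cX t - cY t = cX' t - cY' t) ->
  exists s, [/\ forall i : int, X' i = X (i + s), forall i : int, Y' i = Y (i + s),
    forall t : int, cX' t = cX t - s & forall t : int, cY' t = cY t - s].
Proof.
move=> gX gY gX' gY' S S' E.
have key Z W cZ cW : gal Z cZ -> gal W cW -> sweave Z W -> forall t,
    cW t - cW (t - 1) =
    (if (cZ (t - 1) - cW (t - 1) == 1) && (cZ t - cW t == 0) then 1 else 0).
  move=> gZ gW H t.
  have C := weave_count gZ gW (sweave_weave H).
  have C1 := C (t - 1); have C2 := C t.
  have M1 := gal_count_nondecr gZ (t := t) (s := t - 1) ltac:(lia).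
  have M2 := gal_count_nondecr gW (t := t) (s := t - 1) ltac:(lia).
  have HX := gW (cW t) t; have HX' := gW (cW t) (t - 1).
  have HY := gZ (cZ t) t; have HY' := gZ (cZ t) (t - 1).
  have H1 := H (cW t); have H2 := H (cW t - 1); have H3 := H (cW (t - 1)).
  rewrite subrK in H2.
  have G1 := gW (cW t - 1) (t - 1); have G2 := gZ (cW t) (t - 1).
  have G3 := gZ (cW t) t; have G4 := gZ (cW t + 1) (t-1); have G5 := gZ (cW t + 1) t.
  have G6 := gW (cW t - 1) t.
  by case: ifP; lia.
have Hc (t : int) : cY (t + 1) - cY' (t + 1) = cY t - cY' t.
  have := key _ _ _ _ gX gY S (t + 1); have := key _ _ _ _ gX' gY' S' (t + 1).
  by rewrite addrK -!E; case: ifP; lia.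
have Hs (t : int) : cY t - cY' t = cY 0 - cY' 0.
  by rewrite (int_const (f := fun t => cY t - cY' t) Hc).
exists (cY 0 - cY' 0).
have EY t : cY' t = cY t - (cY 0 - cY' 0) by have := Hs t; lia.
have EX t : cX' t = cX t - (cY 0 - cY' 0) by have := Hs t; have := E t; lia.
split=> // i.
  have := gal_unique_seq _ gX' (gal_shift (cY 0 - cY' 0) 0 gX).
  by move=> -> => [|t]; rewrite ?addr0 // EX subr0.
have := gal_unique_seq _ gY' (gal_shift (cY 0 - cY' 0) 0 gY).
by move=> -> => [|t]; rewrite ?addr0 // EY subr0.
Qed.

(** The difference of the two counts cancels [cJ], so the next level carries the same word up to
    displacement and is renumbered by some [s1]; the counts of the riggings then follow by
    subtraction. *)
Lemma tower_slide_inv r (s0 d : int) J J' X Y X' Y' :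
  tower r J X Y -> tower r J' X' Y' ->
  (forall i : int, X' i = X (i + s0) + d) -> (forall i : int, Y' i = Y (i + s0) + d) ->
  exists s : nat -> int, [/\ s 0%N = s0, s r.+1 = 0
    & forall j, (j <= r)%N -> J' j =1 slide s d J j].
Proof.
elim: r s0 d J J' X Y X' Y' => [|r IHr] s0 d J J' X Y X' Y' /=.
  case=> _ HX _ [_ HX' _] EX _.
  exists (fun j => if j == 0%N then s0 else 0); split=> // j.
  rewrite leqn0 => /eqP -> i; rewrite slide0 /= subr0.
  by have := EX i; rewrite HX HX'; lia.
case=> U [V [cX [cY [cJ [T [gJ gU gV] gX gY]]]]].
case=> U' [V' [cX' [cY' [cJ' [T' [gJ' gU' gV'] gX' gY']]]]] EX EY.
pose e := d + 2 * s0.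
have CX t : cX' t + cJ' t = cX (t - e) + cJ (t - e) - s0.
  move: t; apply: gal_unique_count gX' (gal_shift s0 e gX) => i /=.
  by rewrite EX /e; lia.
have CY t : cY' t + cJ' t = cY (t - e) + cJ (t - e) - s0.
  move: t; apply: gal_unique_count gY' (gal_shift s0 e gY) => i /=.
  by rewrite EY /e; lia.
have gUe := gal_shift 0 e gU; have gVe := gal_shift 0 e gV.
have [s1 [EU EV cU cV]] : exists s, [/\ forall i : int, U' i = U (i + s + 0) + e,
   forall i : int, V' i = V (i + s + 0) + e,
   forall t : int, cX' t = cX (t - e) - 0 - s & forall t : int, cY' t = cY (t - e) - 0 - s].
  apply: (sweave_word_unique gUe gVe gU' gV').
  - have S := tower_sweave T; move=> i; rewrite !addr0; have := S i; lia.
  - exact: tower_sweave T'.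
  - by move=> t; have := CX t; have := CY t; lia.
have [||s [E0 Er Es]] := IHr s1 e _ _ _ _ _ _ T T' _ _.
- by move=> i; rewrite EU addr0.
- by move=> i; rewrite EV addr0.
exists (fun j => if j is j'.+1 then s j' else s0); split=> //.
have CJ : cJ' =1 (fun t : int => cJ (t - e) - (s0 - s1)).
  by move=> t; have := CX t; have := cU t; lia.
case=> [|j] le_j i; last by rewrite slideS Es.
rewrite (gal_unique_seq CJ gJ' (gal_shift (s0 - s1) e gJ)).
by rewrite slide0 /= E0 /e !addrA.
Qed.

(** * Linearization of the carrier dynamics *)

(** In terms of the number [a] of 2's, [R] moves the carrier by a walk clamped between 0 and [k]. *)
Definition cstep (k : int) (b : bool) (a : int) : int :=
  if b then Num.min k (a + 1) else Num.max 0 (a - 1).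

Definition carrier (k : int) (b : int -> bool) (a : int -> int) :=
  forall t : int, 0 <= a t <= k /\ a (t + 1) = cstep k (b t) (a t).

(* [true] is the letter 2; [t] indexes the letter between the cuts [t] and [t + 1]. *)
Definition word (cX cY : int -> int) (t : int) : bool := cY t < cX t.

Lemma carrier_up k b a (s t : int) : carrier k b a -> s <= t ->
  (forall u : int, s <= u < t -> b u) -> a t = Num.min k (a s + (t - s)).
Proof.
move=> C le_st H; move: t le_st H.
apply: (@int_ind_up (fun t : int => (forall u : int, s <= u < t -> b u) -> _)).
  by move=> _; have := (C s).1; lia.
move=> t le_st IH H; have := (C t).2; rewrite H /cstep; last lia.
rewrite IH => [->|u hu]; last by apply: H; lia.
lia.
Qed.

Lemma carrier_down k b a (s t : int) : carrier k b a -> s <= t ->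
  (forall u : int, s <= u < t -> ~~ b u) -> a t = Num.max 0 (a s - (t - s)).
Proof.
move=> C le_st H; move: t le_st H.
apply: (@int_ind_up (fun t : int => (forall u : int, s <= u < t -> ~~ b u) -> _)).
  by move=> _; have := (C s).1; lia.
move=> t le_st IH H; have := (C t).2; rewrite (negbTE (H _ _)) /cstep; last lia.
rewrite IH => [->|u hu]; last by apply: H; lia.
lia.
Qed.

Section Runs.
Variables (X Y cX cY : int -> int).
Hypotheses (gX : gal X cX) (gY : gal Y cY) (W : weave X Y).

Lemma word_up (i : int) (u : int) : X i <= u < Y i -> word cX cY u.
Proof. by rewrite /word; have := gX i u; have := gY i u; lia. Qed.

Lemma word_down (i : int) (u : int) : Y i <= u < X (i + 1) -> ~~ word cX cY u.
Proof. by rewrite /word; have := gX (i + 1) u; have := gY i u; lia. Qed.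

Lemma word_upE (t : int) : word cX cY t ->
  [/\ cY t = cX t - 1, X (cX t) <= t & t < Y (cX t)].
Proof.
rewrite /word => lt; have := weave_count gX gY W t.
by have := gX (cX t) t; have := gY (cX t) t; split; lia.
Qed.

Lemma word_downE (t : int) : ~~ word cX cY t ->
  [/\ cX t = cY t, Y (cX t) <= t & t < X (cX t + 1)].
Proof.
rewrite /word => lt; have := weave_count gX gY W t.
have := gX (cX t + 1) t; have := gY (cX t) t; split; lia.
Qed.

Variables (k : int) (a : int -> int).
Hypothesis C : carrier k (word cX cY) a.

Lemma carrier_peak (i : int) : a (Y i) = Num.min k (a (X i) + (Y i - X i)).
Proof. by apply: carrier_up C _ _; [have := W i; lia | exact: word_up]. Qed.

Lemma carrier_valley (i : int) : a (X (i + 1)) = Num.max 0 (a (Y i) - (X (i + 1) - Y i)).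
Proof. by apply: carrier_down C _ _; [have := W i; lia | exact: word_down]. Qed.

(** While the carrier fills up, 2's come out as 1's; output 2's begin once it is full. So the [i]-th
    output run starts between [X i] and [Y i], and the correction to [cY] asks whether it has
    started by [t]. *)
Lemma evolve_galX : gal (fun i : int => X i + a (Y i) - a (X i))
  (fun t : int => cY t + (if word cX cY t && (a t == k) then 1 else 0)).
Proof.
move=> i t; have P := carrier_peak i; have := (C (Y i)).1; have := (C (X i)).1.
have Wi := W i; have Q := weave_count gX gY W t.
have gi := gX i t; have hi := gY i t.
have [up|dn] /= := boolP (word cX cY t); last by have [] := word_downE dn; lia.
have [E lt1 lt2] := word_upE up.
have [E'|ne] := eqVneq i (cX t); last first.
  rewrite /=; case: ifP; lia.
have -> : a t = Num.min k (a (X i) + (t - X i)).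
  by apply: carrier_up C _ _; [lia | move=> u hu; apply: (@word_up i); lia].
by case: ifP; lia.
Qed.

(** After the run of 2's the carrier keeps emitting 2's until it is empty or the next run begins, so
    the output run ends between [Y i] and [X (i + 1)]; the correction discounts a run still going
    on. *)
Lemma evolve_galY : gal (fun i : int => Y i + a (Y i) - a (X (i + 1)))
  (fun t : int => cY t - (if ~~ word cX cY t && (0 < a t) then 1 else 0)).
Proof.
move=> i t; have P := carrier_valley i.
have := (C (Y i)).1; have := (C (X (i + 1))).1.
have Wi := W i; have Wi1 := W (i + 1); have Q := weave_count gX gY W t.
have gi := gX (i + 1) t; have hi := gY i t.
have [up|dn] /= := boolP (word cX cY t); first by have [] := word_upE up; lia.
have [E lt1 lt2] := word_downE dn.
have [E'|ne] := eqVneq i (cX t); last first.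
  rewrite /=; case: ifP; lia.
have -> : a t = Num.max 0 (a (Y i) - (t - Y i)).
  apply: carrier_down C _ _; first lia.
  by move=> u hu; rewrite -E' in lt2; apply: (@word_down i); lia.
by case: ifP; lia.
Qed.

End Runs.

Lemma seq_carrier X Y cX cY (k : int) A B : gal X cX -> gal Y cY -> sweave X Y ->
  (forall i : int, [/\ 0 <= A i <= k, 0 <= B i <= k,
     A i = Num.min k (B i + (Y i - X i)) &
     B (i + 1) = Num.max 0 (A i - (X (i + 1) - Y i))]) ->
  exists a, [/\ carrier k (word cX cY) a, forall i : int, a (Y i) = A i
    & forall i : int, a (X i) = B i].
Proof.
move=> gX gY S H; have W := sweave_weave S.
(* Loads are interpolated from the last cut: upward from a 12-cut, downward from a 21-cut. *)
pose a t := if word cX cY t then Num.min k (B (cX t) + (t - X (cX t)))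
  else Num.max 0 (A (cY t) - (t - Y (cY t))).
have aX (i : int) : a (X i) = B i.
  have E : cX (X i) = i by have := gX i (X i); have := gX (i + 1) (X i); have := S i; lia.
  have E' : cY (X i) = i - 1.
    have := gY i (X i); have := gY (i - 1) (X i); have := S i; have := S (i - 1).
    by rewrite subrK; lia.
  rewrite /a /word E E'; case: ifP; have [? ? ? ?] := H i; lia.
have aY (i : int) : a (Y i) = A i.
  have E : cY (Y i) = i.
    by have := gY i (Y i); have := gY (i + 1) (Y i); have := S i; have := S (i + 1); lia.
  have E' : cX (Y i) = i.
    have := gX i (Y i); have := gX (i + 1) (Y i); have := S i; lia.
  rewrite /a /word E E'; case: ifP; have [? ? ? ?] := H i; lia.
exists a; split=> // t; split.
  rewrite /a; case: ifP => [up|/negbT dn].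
    by have [E ? ?] := word_upE gX gY W up; have [? ? ? ?] := H (cX t); lia.
  have [E ? ?] := word_downE gX gY W dn; have [? ? ? ?] := H (cX t).
  by rewrite -E; lia.
have [up|dn] /= := boolP (word cX cY t).
  have [E lt1 lt2] := word_upE gX gY W up.
  have [eq|lt] : t + 1 = Y (cX t) \/ t + 1 < Y (cX t) by lia.
    by rewrite eq aY /cstep /a up; have [? ? ? ?] := H (cX t); lia.
  have up1 : word cX cY (t + 1) by apply: (word_up gX gY (i := cX t)); lia.
  have E1 : cX (t + 1) = cX t.
    have := gX (cX t) (t + 1); have := gX (cX t + 1) (t + 1); have := S (cX t); lia.
  by rewrite /a up up1 E1 /cstep; lia.
have [E lt1 lt2] := word_downE gX gY W dn.
have [eq|lt] : t + 1 = X (cX t + 1) \/ t + 1 < X (cX t + 1) by lia.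
  by rewrite eq aX /cstep /a (negbTE dn); have [? ? ? ?] := H (cX t); rewrite -E; lia.
have dn1 : ~~ word cX cY (t + 1) by apply: (word_down gX gY (i := cX t)); lia.
have E1 : cX (t + 1) = cX t.
  have := gX (cX t) (t + 1); have := gX (cX t + 1) (t + 1); have := S (cX t); lia.
have [E2 _ _] := word_downE gX gY W dn1.
by rewrite /a (negbTE dn) (negbTE dn1) -E2 E1 -E /cstep; lia.
Qed.

Definition evolved (k : nat) (J : nat -> int -> int) (j : nat) (i : int) : int :=
  J j i + (minn j.+1 k)%:Z.

Lemma tower_evolve0 r J X Y cX cY : tower r J X Y -> gal X cX -> gal Y cY ->
  exists a, [/\ carrier 0 (word cX cY) a,
    forall t : int, exists i, X i <= t /\ a (X i) = 0
    & tower r (evolved 0 J) (fun i : int => X i + a (Y i) - a (X i))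
        (fun i : int => Y i + a (Y i) - a (X (i + 1)))].
Proof.
move=> T gX gY; exists (fun=> 0); split=> [t|t|].
- by split=> //; rewrite /cstep; case: (word _ _ _); lia.
- by exists (cX t); rewrite gX.
- by apply: tower_ext T => [j _ i|i|i]; rewrite /evolved ?minn0 ?addr0 ?subr0.
Qed.

Lemma tower_evolve r (k : nat) J X Y cX cY : tower r J X Y -> gal X cX -> gal Y cY ->
  exists a, [/\ carrier k%:Z (word cX cY) a,
    forall t : int, exists i, X i <= t /\ a (X i) = 0
    & tower r (evolved k J) (fun i : int => X i + a (Y i) - a (X i))
        (fun i : int => Y i + a (Y i) - a (X (i + 1)))].
Proof.
elim: r k J X Y cX cY => [|r IHr] k J X Y cX cY T gX gY;
  (case: k => [|k]; first exact: tower_evolve0 T gX gY).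
  have S := tower_sweave T; have [M HX HY] := T.
  (* At the last level all runs of 2's have length one, so a carrier of positive capacity holds one
     2 after each run and none before the next. *)
  have [|a [C aY aX]] := seq_carrier (k := k.+1%:Z) (A := fun=> 1) (B := fun=> 0) gX gY S.
    by move=> i; have := M i; rewrite !HX !HY; split; lia.
  exists a; split=> //; first by move=> t; exists (cX t); rewrite gX aX.
  by split=> i; rewrite ?aX ?aY /evolved ?HX ?HY ?(minn_idPl _) //; have := M i; lia.
have S := tower_sweave T.
case: T => U [V [cU [cV [cJ [T [gJ gU gV] gX1 gY1]]]]].
have [a [C Z T']] := IHr k _ _ _ _ _ T gU gV.
have WU := sweave_weave (tower_sweave T).
(* Cuts inserted into both sequences at the same points do not change the word, so [a] also serves
   the merged sequences. *)
have Ew : word (fun t : int => cU t + cJ t) (fun t : int => cV t + cJ t) =1 word cU cV.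
  by move=> t; rewrite /word; lia.
have C1 : carrier k (word (fun t : int => cU t + cJ t) (fun t : int => cV t + cJ t)) a.
  by move=> t; rewrite Ew.
have W1 : weave (fun i : int => X i - (2 * i - 1)) (fun i : int => Y i - 2 * i).
  by move=> i; have := S i; lia.
have P := carrier_peak gX1 gY1 W1 C1; have Q := carrier_valley gX1 gY1 W1 C1.
(* Undoing the KKR step lengthens each run by one: the peaks of the load rise by one together with
   the capacity, and the valleys keep their values. *)
have [|b [Cb bY bX]] := seq_carrier (k := k.+1%:Z)
  (A := fun i : int => a (Y i - 2 * i) + 1) (B := fun i : int => a (X i - (2 * i - 1))) gX gY S.
  move=> i; have := P i; have := Q i; have := (C (Y i - 2 * i)).1.
  by have := (C (X i - (2 * i - 1))).1; have := S i; split; lia.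
exists b; split=> // [t|].
  (* An empty load at [U i] reappears at the last index [j] that the merged sequence has at this
     position; the final [- 1] forces [j < cX t]. *)
  have [i [le_i ai]] := Z (X (cX t) - (2 * cX t - 1) - 1).
  have J1 := gal_jump (t := U i) gX1.
  have [lt1 lt2] : cU (U i - 1) < cU (U i) /\ cJ (U i - 1) <= cJ (U i).
    have := gU i (U i - 1); have := gU i (U i); have := gal_count_nondecr gJ (s := U i - 1) (t := U i).
    lia.
  have {J1} := J1 ltac:(lia); set j := cU (U i) + cJ (U i) => J1.
  have := gX1 j (X (cX t) - (2 * cX t - 1) - 1).
  have := gX1 (cX t) (X (cX t) - (2 * cX t - 1) - 1).
  by exists j; rewrite bX J1 gX; split=> //; lia.
set Ue := (fun i : int => U i + _ - _) in T'; set Ve := (fun i : int => V i + _ - _) in T'.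
(* The next level is the evolved smaller tower displaced by one: [minn j.+1 k + 1] is
   [minn j.+2 k.+1], and the split-off riggings move by [minn 1 k.+1 = 1]. *)
exists (fun i : int => Ue (i + 0) + 1), (fun i : int => Ve (i + 0) + 1).
exists (fun t : int => cV (t - 1) + (if word cU cV (t - 1) && (a (t - 1) == k) then 1 else 0)).
exists (fun t : int => cV (t - 1) - (if ~~ word cU cV (t - 1) && (0 < a (t - 1)) then 1 else 0)).
exists (fun t : int => cJ (t - 1)); split.
- apply: tower_ext (tower_slide (s := fun=> 0) 1 (erefl _) T') => // j _ i.
  have E0 : \sum_(l < j.+1) (0 : int) = 0 by rewrite big1.
  by rewrite /slide E0 addr0 subr0 addr0 /evolved minnSS; lia.
- split.
  + by apply: gal_ext (gal_shift 0 1 gJ) => [i|t]; rewrite ?addr0 ?subr0 /evolved ?minnSS ?min0n.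
  + by apply: gal_ext (gal_shift 0 1 (evolve_galX gU gV WU C)) => // t; rewrite subr0.
  + by apply: gal_ext (gal_shift 0 1 (evolve_galY gU gV WU C)) => // t; rewrite subr0.
- apply: gal_ext (gal_shift 0 1 (evolve_galX gX1 gY1 W1 C1)) => [i|t].
    by rewrite bX bY addr0; lia.
  by rewrite subr0 Ew addrAC.
apply: gal_ext (gal_shift 0 1 (evolve_galY gX1 gY1 W1 C1)) => [i|t].
  by rewrite bX bY addr0; lia.
by rewrite subr0 Ew addrAC.
Qed.

(** * Periodic carriers of finite paths *)

Lemma modz_succ (t : int) (L : nat) : (0 < L)%N ->
  ((t + 1) %% L%:Z)%Z = if (t %% L%:Z)%Z + 1 < L%:Z then (t %% L%:Z)%Z + 1 else 0.
Proof.
move=> L0; rewrite -modzDml; case: ifP => [lt|ge]; first by rewrite modz_small //; lia.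
by have -> : (t %% L%:Z)%Z + 1 = L%:Z by [lia]; rewrite modzz.
Qed.

Definition pword (p : seq nat) (t : int) : bool :=
  nth 0%N p (absz (t %% (size p)%:Z)%Z) == 2%N.

(** Tells whether [R] emits a 2: a full carrier passes a 2 on, and a nonempty one exchanges a 1 for
    a 2. *)
Definition cout (k : int) (b : bool) (a : int) : bool := if b then a == k else 0 < a.

Definition load (k v : nat) (p : seq nat) (t : nat) : nat :=
  foldl (fun a b => (Rmap k a b).2) v (take t p).

Lemma load0 k v p : load k v p 0 = v.
Proof. by rewrite /load take0. Qed.

Lemma loadS k v p t : (t < size p)%N ->
  load k v p t.+1 = (Rmap k (load k v p t) (nth 0%N p t)).2.
Proof. by move=> lt; rewrite /load (take_nth 0%N lt) -cats1 foldl_cat. Qed.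

Lemma run_load k v p : (run k v p).2 = load k v p (size p).
Proof. by rewrite /load take_size; elim: p v => //= b p IHp v; rewrite IHp. Qed.

Lemma size_run k v p : size (run k v p).1 = size p.
Proof. by elim: p v => //= b p IHp v; rewrite IHp. Qed.

Lemma nth_run k v p t : (t < size p)%N ->
  nth 0%N (run k v p).1 t = (Rmap k (load k v p t) (nth 0%N p t)).1.
Proof.
elim: p v t => // b p IHp v [|t] lt //=.
by rewrite IHp // /load.
Qed.

Lemma Rmap_step k a b : (a <= k)%N -> (b == 1%N) || (b == 2%N) ->
  ((Rmap k a b).2)%:Z = cstep k%:Z (b == 2%N) a%:Z.
Proof.
rewrite /Rmap /cstep => le_a /orP[]/eqP -> /=; case: ifP => /eqP E /=; lia.
Qed.

Lemma Rmap_out k a b : (a <= k)%N -> (b == 1%N) || (b == 2%N) ->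
  (Rmap k a b).1 = if cout k%:Z (b == 2%N) a%:Z then 2%N else 1%N.
Proof.
by rewrite /Rmap /cout => le_a /orP[]/eqP -> /=; case: ifP => /eqP E /=; case: ifP => //; lia.
Qed.

Section Load.
Variables (k : nat) (p : seq nat).
Hypothesis letters : all (fun b => (b == 1%N) || (b == 2%N)) p.

Lemma letterP t : (t < size p)%N -> (nth 0%N p t == 1%N) || (nth 0%N p t == 2%N).
Proof. by move=> lt; apply: (allP letters); apply: mem_nth. Qed.

Lemma load_step v t : (t < size p)%N -> (load k v p t <= k)%N ->
  (load k v p t.+1)%:Z = cstep k%:Z (nth 0%N p t == 2%N) (load k v p t)%:Z.
Proof. by move=> lt le; rewrite loadS // Rmap_step // letterP. Qed.

Lemma load_le v t : (v <= k)%N -> (t <= size p)%N -> (load k v p t <= k)%N.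
Proof.
move=> le_v; elim: t => [|t IHt] lt; first by rewrite load0.
by have := load_step lt (IHt (ltnW lt)); have := IHt (ltnW lt); rewrite /cstep; case: ifP; lia.
Qed.

Lemma load_mono v v' t : (v <= v')%N -> (v' <= k)%N -> (t <= size p)%N ->
  (load k v p t <= load k v' p t)%N.
Proof.
move=> le_v le_v'; elim: t => [|t IHt] lt; first by rewrite !load0.
have l1 := load_le le_v' (ltnW lt); have l2 := load_le (leq_trans le_v le_v') (ltnW lt).
have := load_step lt l1; have := load_step lt l2; have := IHt (ltnW lt).
by rewrite /cstep; case: ifP; lia.
Qed.

Lemma load_merge v v' t s : load k v p t = load k v' p t -> (t <= s <= size p)%N ->
  load k v p s = load k v' p s.
Proof.
move=> E; elim: s => [|s IHs] /andP[le lt]; first by have -> : 0%N = t by lia.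
have [<- //|ne] := eqVneq t s.+1.
by rewrite !loadS // IHs //; lia.
Qed.

Definition walk (t : nat) : int :=
  (count (pred1 2%N) (take t p))%:Z - (count (pred1 1%N) (take t p))%:Z.

Lemma walkS t : (t < size p)%N ->
  walk t.+1 = walk t + (if nth 0%N p t == 2%N then 1 else -1).
Proof.
move=> lt; rewrite /walk (take_nth 0%N lt) -cats1 !count_cat /=.
by have := letterP lt; case: ifP; lia.
Qed.

(** Take for [s] the last time a 1 met an empty carrier, or the start. Since then the load has
    followed the walk, apart from losses at saturation. *)
Lemma load0_walk t : (t <= size p)%N ->
  exists2 s, (s <= t)%N & (load k 0 p t)%:Z <= walk t - walk s.
Proof.
elim: t => [|t IHt] lt; first by exists 0%N => //; rewrite load0 subrr.
have [s le_s IH] := IHt (ltnW lt).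
have := load_step lt (load_le (leq0n k) (ltnW lt)); rewrite /cstep.
have W := walkS lt; have [b|/negbTE b] := boolP (nth 0%N p t == 2%N).
  by exists s; move: W; rewrite b; lia.
move: W; rewrite b => W E.
have [z|nz] := eqVneq (load k 0 p t) 0%N; first by exists t.+1 => //; lia.
by exists s; lia.
Qed.

Lemma load_walk v t : (v <= k)%N -> (t <= size p)%N ->
  (forall s, (s <= size p)%N -> (0 < load k v p s)%N) ->
  (load k v p t)%:Z <= v%:Z + walk t.
Proof.
move=> le_v le_t pos; elim: t le_t => [|t IHt] lt.
  by rewrite load0 /walk take0 /= subrr addr0.
have := load_step lt (load_le le_v (ltnW lt)); rewrite /cstep.
have := IHt (ltnW lt); have := walkS lt; have := pos _ (ltnW lt).
by case: ifP; lia.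
Qed.

Hypothesis excess : (count (pred1 2%N) p <= count (pred1 1%N) p)%N.
Let v := load k 0 p (size p).

(** The run from [v] stays above the run from 0. Where it is empty the two meet, and they agree from
    there on, so it also ends at [v]. *)
Lemma load_return :
  load k v p (size p) = v /\ exists2 t, (t <= size p)%N & load k v p t = 0%N.
Proof.
have le_v : (v <= k)%N by apply: load_le.
have mono t : (t <= size p)%N -> (load k 0 p t <= load k v p t)%N by apply: load_mono.
have [/hasP[t]|none] := boolP (has (fun t => load k v p t == 0%N) (iota 0 (size p).+1)).
  rewrite mem_iota => /= lt /eqP z; split; last by exists t => //; lia.
  have E : load k 0 p t = load k v p t by have := mono t; lia.
  by rewrite -(load_merge (s := size p) E) //; lia.
have pos s : (s <= size p)%N -> (0 < load k v p s)%N.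
  move=> le; rewrite lt0n; apply: contra none => z.
  by apply/hasP; exists s => //; rewrite mem_iota; lia.
(* A load that is never empty is at most [v] plus the walk. As it ends at [v] or more, the walk must
   end at 0; then [v <= - walk s], so the load at [s] would vanish. *)
have [s le_s] := load0_walk (leqnn _); rewrite -/v => H.
have wL : walk (size p) <= 0 by rewrite /walk take_size; lia.
have := load_walk le_v le_s pos; have := load_walk le_v (leqnn _) pos.
by have := pos s le_s; have := mono _ (leqnn _); rewrite -/v; lia.
Qed.

End Load.

Lemma inP_all L p : inP L p ->
  [/\ size p = L, all (fun b => (b == 1%N) || (b == 2%N)) p
    & (count (pred1 2%N) p <= count (pred1 1%N) p)%N].
Proof. by case/and3P => /eqP. Qed.

Lemma pword_nth p t : (t < size p)%N -> pword p t%:Z = (nth 0%N p t == 2%N).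
Proof. by move=> lt; rewrite /pword modz_small //; lia. Qed.

Lemma size_Tk k p : size (Tk k p) = size p.
Proof. exact: size_run. Qed.

Lemma Tk_carrier k L p : inP L p -> (0 < L)%N -> exists a : int -> int,
  [/\ carrier k%:Z (pword p) a, forall t : int, a (t + L%:Z) = a t,
      exists t0, a t0 = 0
    & forall t, (t < L)%N -> nth 0%N (Tk k p) t =
        if cout k%:Z (pword p t%:Z) (a t%:Z) then 2%N else 1%N].
Proof.
move=> /inP_all [sz lets exc] L0.
have [ret [t0 le_t0 z]] := load_return k lets exc.
move: ret z; set v := load k 0 p (size p) => ret z.
have le_v : (v <= k)%N by apply: load_le.
exists (fun t : int => (load k v p (absz (t %% L%:Z)%Z))%:Z); split.
- move=> t; set i := absz _; have lt : (i < size p)%N by rewrite /i; lia.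
  have l := load_le lets le_v (ltnW lt); split; first lia.
  rewrite /pword sz -/i -load_step //.
  rewrite modz_succ //; case: ifP => E.
    by congr (load _ _ _ _)%:Z; rewrite /i; lia.
  by have -> : i.+1 = size p by [rewrite /i; lia]; rewrite ret load0.
- by move=> t; rewrite modzDr.
- have [E|ne] := eqVneq t0 L.
    by exists 0; rewrite mod0z load0 -ret sz -E z.
  exists t0%:Z; rewrite modz_small ?z //; lia.
move=> t lt; rewrite /Tk nth_run ?sz // run_load -/v.
rewrite modz_small ?absz_nat; last lia.
by rewrite Rmap_out ?letterP ?load_le // ?pword_nth ?sz // ltnW.
Qed.

Lemma periodic_mul (T : Type) (a : int -> T) (L : nat) :
  (forall t : int, a (t + L%:Z) = a t) -> forall (z t : int), a (t + z * L%:Z) = a t.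
Proof.
move=> per z t; rewrite (int_const (f := fun z => a (t + z * L%:Z))) ?mul0r ?addr0 //.
by move=> u; rewrite mulrDl mul1r addrA per.
Qed.

Lemma periodic_zero (a : int -> int) (L : nat) : (0 < L)%N ->
  (forall t : int, a (t + L%:Z) = a t) -> (exists t0, a t0 = 0) ->
  (forall t : int, exists2 u, u <= t & a u = 0) /\
  (forall t : int, exists2 u, t <= u & a u = 0).
Proof.
move=> L0 per [t0 z]; have P := periodic_mul per; split=> t.
  by exists (t0 + - (absz t0 + absz t)%:Z * L%:Z); rewrite ?P //; nia.
by exists (t0 + (absz t0 + absz t)%:Z * L%:Z); rewrite ?P //; nia.
Qed.

(** * Uniqueness and reversibility of carriers *)

Lemma carrier_mono k b a a' (s t : int) : carrier k b a -> carrier k b a' ->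
  a s <= a' s -> s <= t -> a t <= a' t.
Proof.
move=> C C' le_s; move: t; apply: int_ind_up => // t _ IH.
by rewrite (C t).2 (C' t).2 /cstep; case: ifP; lia.
Qed.

(** Carriers of one word keep their order, and where one is empty the other is at least as large.
    Empty points of both arbitrarily far in the past give both inequalities. *)
Lemma carrier_unique k b a a' : carrier k b a -> carrier k b a' ->
  (forall t : int, exists2 u, u <= t & a u = 0) ->
  (forall t : int, exists2 u, u <= t & a' u = 0) -> a =1 a'.
Proof.
move=> C C' Z Z' t; have [u le_u z] := Z t; have [u' le_u' z'] := Z' t.
have := (C u').1; have := (C' u).1.
have := @carrier_mono _ _ _ _ u t C C'; have := @carrier_mono _ _ _ _ u' t C' C.
by rewrite z z'; lia.
Qed.

(* Read from right to left, a carrier is again a clamped walk, driven by the outputs. *)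
Lemma carrier_back k b a (t : int) : carrier k b a ->
  a t = cstep k (cout k (b t) (a t)) (a (t + 1)).
Proof.
move=> C; have [r ->] := C t; rewrite /cstep /cout; case: (b t); case: ifP; lia.
Qed.

Lemma carrier_letter k b a (t : int) : carrier k b a ->
  b t = if cout k (b t) (a t) then a (t + 1) == k else 0 < a (t + 1).
Proof.
move=> C; have [r ->] := C t; rewrite /cstep /cout.
by case: (b t); case: ifP; lia.
Qed.

Lemma carrier_back_mono k b a b' a' (s t : int) : carrier k b a -> carrier k b' a' ->
  (forall t : int, cout k (b t) (a t) = cout k (b' t) (a' t)) ->
  a s <= a' s -> t <= s -> a t <= a' t.
Proof.
move=> C C' E le_s; move: t; apply: int_ind_down => // t _ IH.
rewrite (carrier_back t C) (carrier_back t C') E /cstep; case: ifP; lia.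
Qed.

(** The same comparison run from the far right, where the output word drives the loads; it makes
    [Tk k] injective. *)
Lemma carrier_back_unique k b a b' a' : carrier k b a -> carrier k b' a' ->
  (forall t : int, cout k (b t) (a t) = cout k (b' t) (a' t)) ->
  (forall t : int, exists2 u, t <= u & a u = 0) ->
  (forall t : int, exists2 u, t <= u & a' u = 0) -> b =1 b'.
Proof.
move=> C C' E Z Z' t.
have Ea : a (t + 1) = a' (t + 1).
  have [u le_u z] := Z (t + 1); have [u' le_u' z'] := Z' (t + 1).
  have := (C u').1; have := (C' u).1.
  have := @carrier_back_mono _ _ _ _ _ u (t + 1) C C' E.
  have := @carrier_back_mono _ _ _ _ _ u' (t + 1) C' C (fun t => esym (E t)).
  by rewrite z z'; lia.
by rewrite (carrier_letter t C) (carrier_letter t C') E Ea.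
Qed.

Lemma run_letters k v p : all (fun b => (b == 1%N) || (b == 2%N)) (run k v p).1.
Proof.
elim: p v => //= b p IHp v; rewrite IHp andbT /Rmap.
by do 2?case: ifP => //= _; rewrite ?eqxx ?orbT.
Qed.

Lemma run_count k v p : (v <= k)%N -> all (fun b => (b == 1%N) || (b == 2%N)) p ->
  (count (pred1 2%N) (run k v p).1 + (run k v p).2 = count (pred1 2%N) p + v)%N.
Proof.
elim: p v => //= b p IHp v le_v /andP[bP lp].
have H : (((Rmap k v b).1 == 2) + (Rmap k v b).2 = (b == 2) + v)%N.
  by rewrite /Rmap; case/orP: bP => /eqP -> /=; case: ifP => /eqP /=; lia.
have le : ((Rmap k v b).2 <= k)%N.
  by rewrite /Rmap; case/orP: bP => /eqP -> /=; case: ifP => /eqP /=; lia.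
by have := IHp _ le lp; lia.
Qed.

Lemma count_letters p : all (fun b => (b == 1%N) || (b == 2%N)) p ->
  (count (pred1 1%N) p + count (pred1 2%N) p = size p)%N.
Proof.
by elim: p => //= b p IHp /andP[bP lp]; have := IHp lp; case/orP: bP => /eqP -> /=; lia.
Qed.

Lemma inP_Tk k L p : inP L p -> inP L (Tk k p).
Proof.
move=> /inP_all [sz lets exc]; have [ret _] := load_return k lets exc.
rewrite /inP size_Tk sz eqxx run_letters /=.
have := @run_count k (run k 0 p).2 p; rewrite !run_load ret.
have := count_letters lets; have := count_letters (run_letters k (run k 0 p).2 p).
have := load_le lets (leq0n k) (leqnn _).
rewrite size_run /Tk !run_load => l /eqP c1 c2 /(_ l lets) /addIn c3.
by move: c1; rewrite c3 -c2 eqn_add2r => /eqP ->.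
Qed.

Lemma inP_eq L p q : inP L p -> inP L q -> pword p =1 pword q -> p = q.
Proof.
move=> /inP_all [sp lp _] /inP_all [sq lq _] E.
apply: (@eq_from_nth _ 0%N) => [|i lt]; first by rewrite sp sq.
have := E i%:Z; rewrite !pword_nth ?sq -?sp //.
have := letterP lp lt; have := letterP lq (t := i); rewrite sq -sp => /(_ lt).
lia.
Qed.

Lemma pword_periodic p (t : int) : pword p (t %% (size p)%:Z)%Z = pword p t.
Proof. by rewrite /pword modz_mod. Qed.

Lemma pword_Tk k L p a : inP L p -> (0 < L)%N -> (forall t : int, a (t + L%:Z) = a t) ->
  (forall t, (t < L)%N -> nth 0%N (Tk k p) t =
     if cout k%:Z (pword p t%:Z) (a t%:Z) then 2%N else 1%N) ->
  forall t : int, pword (Tk k p) t = cout k%:Z (pword p t) (a t).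
Proof.
move=> /inP_all [sz _ _] L0 per H t.
have P := periodic_mul per.
rewrite /pword size_Tk sz H; last lia.
have -> : (absz (t %% L%:Z)%Z)%:Z = (t %% L%:Z)%Z by lia.
have -> : a (t %% L%:Z)%Z = a t by rewrite {2}(divz_eq t L%:Z) addrC P.
rewrite -/(pword _ _) -{1}sz pword_periodic /pword sz.
by case: (cout _ _ _).
Qed.

Lemma Tk_inj k L p q : (0 < L)%N -> inP L p -> inP L q -> Tk k p = Tk k q -> p = q.
Proof.
move=> L0 Pp Pq E.
have [a [C per Z H]] := Tk_carrier k Pp L0.
have [a' [C' per' Z' H']] := Tk_carrier k Pq L0.
apply: (inP_eq Pp Pq); apply: (carrier_back_unique C C').
- by move=> t; rewrite -(pword_Tk Pp L0 per H) -(pword_Tk Pq L0 per' H') E.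
- by have [] := periodic_zero L0 per Z.
- by have [] := periodic_zero L0 per' Z'.
Qed.

Lemma inP_iter k n L p : inP L p -> inP L (iter n (Tk k) p).
Proof. by move=> Pp; elim: n => //= n; apply: inP_Tk. Qed.

Lemma iter_Tk_inj k n L p q : (0 < L)%N -> inP L p -> inP L q ->
  iter n (Tk k) p = iter n (Tk k) q -> p = q.
Proof.
by move=> L0 Pp Pq; elim: n => //= n IHn E; apply: IHn; apply: (Tk_inj L0 _ _ E); apply: inP_iter.
Qed.

Definition bits L (p : seq nat) : L.-tuple bool := [tuple nth 0%N p i == 2%N | i < L].

Lemma bitsK L p : inP L p -> map letter (bits L p) = p.
Proof.
move=> /inP_all [sz lets _].
apply: (@eq_from_nth _ 0%N) => [|i]; rewrite size_map size_tuple ?sz // => lt.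
rewrite (nth_map false) ?size_tuple // -(tnth_nth _ _ (Ordinal lt)) tnth_mktuple /=.
by rewrite /letter; have := letterP lets (t := i); rewrite sz => /(_ lt) /orP[]/eqP ->.
Qed.

(** Two iterates coincide by pigeonhole, and injectivity cancels the smaller one. Hence the search
    in [Tinv] succeeds, and inverse powers are forward powers. *)
Lemma Tk_order k L p : (0 < L)%N -> inP L p -> exists n, iter n.+1 (Tk k) p = p.
Proof.
move=> L0 Pp; pose f (i : 'I_(#|{: L.-tuple bool}|.+1)) := bits L (iter i (Tk k) p).
have [i [j [lt E]]] : exists i j : nat, (i < j)%N /\ iter i (Tk k) p = iter j (Tk k) p.
  have /injectivePn [i [j ne E]] : ~~ injectiveb f.
    by apply/injectiveP => /leq_card; rewrite card_ord ltnn.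
  have {E} : iter i (Tk k) p = iter j (Tk k) p.
    by rewrite -(bitsK (inP_iter k i Pp)) -(bitsK (inP_iter k j Pp)) -/(f i) E.
  have /orP[lt|lt] : (i < j)%N || (j < i)%N by rewrite -neq_ltn.
    by exists i, j.
  by exists j, i.
exists (j - i).-1; apply: (@iter_Tk_inj k i L) => //; first exact: inP_iter.
by rewrite -iterD E; congr iter; lia.
Qed.

Lemma Tinv_spec k L q : (0 < L)%N -> inP L q -> inP L (Tinv k q) /\ Tk k (Tinv k q) = q.
Proof.
move=> L0 Pq; have [sz _ _] := inP_all Pq; rewrite /Tinv sz.
case: pickP => [t /andP[Pt /eqP E] // | none].
have [n E] := Tk_order k L0 Pq.
by have := none (bits L (iter n (Tk k) q)); rewrite bitsK inP_iter //= -iterS E eqxx.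
Qed.

(** * Angle variables of a path *)

(** A relation, since one path has many families of riggings, all related by [slide]. *)
Definition angle_of (L r : nat) (J : nat -> int -> int) (p : seq nat) : Prop :=
  inP L p /\ exists X Y cX cY, [/\ tower r J X Y, gal X cX, gal Y cY
    & forall t : int, pword p t = word cX cY t].

Lemma angle_of_ext L r J J' p : (forall j, (j <= r)%N -> J j =1 J' j) ->
  angle_of L r J p -> angle_of L r J' p.
Proof.
move=> E [Pp [X [Y [cX [cY [T gX gY H]]]]]]; split=> //.
by exists X, Y, cX, cY; split=> //; apply: tower_ext T.
Qed.

Lemma angle_of_unique L r J p p' : angle_of L r J p -> angle_of L r J p' -> p = p'.
Proof.
move=> [Pp [X [Y [cX [cY [T gX gY H]]]]]] [Pp' [X' [Y' [cX' [cY' [T' gX' gY' H']]]]]].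
have [EX EY] := tower_unique T T'; apply: (inP_eq Pp Pp') => t.
by rewrite H H' /word (gal_unique_count EX gX gX') (gal_unique_count EY gY gY').
Qed.

Lemma angle_of_slide L r J p (s : nat -> int) : s r.+1 = 0 ->
  angle_of L r J p -> angle_of L r (slide s 0 J) p.
Proof.
move=> sr [Pp [X [Y [cX [cY [T gX gY H]]]]]]; split=> //.
exists (fun i : int => X (i + s 0%N) + 0), (fun i : int => Y (i + s 0%N) + 0).
exists (fun t : int => cX (t - 0) - s 0%N), (fun t : int => cY (t - 0) - s 0%N).
split; [exact: tower_slide | exact: gal_shift | exact: gal_shift |].
by move=> t; rewrite H /word subr0; lia.
Qed.

Lemma angle_of_slide_inv L r J J' p : angle_of L r J p -> angle_of L r J' p ->
  exists s : nat -> int, s r.+1 = 0 /\ forall j, (j <= r)%N -> J' j =1 slide s 0 J j.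
Proof.
move=> [Pp [X [Y [cX [cY [T gX gY H]]]]]] [_ [X' [Y' [cX' [cY' [T' gX' gY' H']]]]]].
have S := tower_sweave T; have S' := tower_sweave T'.
have [|s [EX EY _ _]] := sweave_word_unique gX gY gX' gY' S S'.
  move=> t; have := weave_count gX gY (sweave_weave S) t.
  have := weave_count gX' gY' (sweave_weave S') t.
  by have := H t; rewrite H' /word; lia.
have [||u [_ ur Eu]] := @tower_slide_inv _ s 0 _ _ _ _ _ _ T T'.
- by move=> i; rewrite EX addr0.
- by move=> i; rewrite EY addr0.
by exists u.
Qed.

Lemma slide_opp (s : nat -> int) J j : slide (fun l => - s l) 0 (slide s 0 J) j =1 J j.
Proof.
move=> i; rewrite /slide sumrN.
have -> : i + - s j - - s j.+1 + s j - s j.+1 = i by lia.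
set S := \sum_(l < _) _; lia.
Qed.

Lemma angle_of_Tk (L r k : nat) J p : (0 < L)%N ->
  angle_of L r J p -> angle_of L r (evolved k J) (Tk k p).
Proof.
move=> L0 [Pp [X [Y [cX [cY [T gX gY H]]]]]].
have [a [C Z T']] := tower_evolve k T gX gY.
have [a' [C' per Z' out]] := Tk_carrier k Pp L0.
have W := sweave_weave (tower_sweave T).
have Cw : carrier k%:Z (word cX cY) a' by move=> t; rewrite -H; apply: C'.
(* Both carriers are empty arbitrarily early: that of the tower at 12-cuts, that of [Tk] by
   periodicity. *)
have Ea : a =1 a'.
  apply: (carrier_unique C Cw).
    by move=> t; have [i [le_i z]] := Z t; exists (X i).
  by have [] := periodic_zero L0 per Z'.
split; first exact: inP_Tk.
have gXn := evolve_galX gX gY W C; have gYn := evolve_galY gX gY W C.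
eexists _, _, _, _; split; [exact: T' | exact: gXn | exact: gYn |].
move=> t; rewrite (pword_Tk Pp L0 per out) H -Ea /cout.
rewrite {2}/word; case: (word cX cY t) => /=; case: ifP; lia.
Qed.

Lemma angle_of_iter (L r k n : nat) J p : (0 < L)%N -> angle_of L r J p ->
  angle_of L r (fun j i => J j i + n%:Z * (minn j.+1 k)%:Z) (iter n (Tk k) p).
Proof.
move=> L0 R; elim: n => [|n IHn] /=.
  by apply: angle_of_ext R => j _ i; rewrite mul0r addr0.
by apply: angle_of_ext (angle_of_Tk k L0 IHn) => j _ i; rewrite /evolved; lia.
Qed.

(** With [n.+1] a period of [Tk k] at [p], the inverse is the [n]-th iterate. Its riggings exceed
    the claimed ones by [n.+1] times [minn j.+1 k]; this displacement fixes [p], hence is a [slide],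
    and sliding back removes it. *)
Lemma angle_of_Tinv (L r k : nat) J p : (0 < L)%N -> angle_of L r J p ->
  angle_of L r (fun j i => J j i - (minn j.+1 k)%:Z) (Tinv k p).
Proof.
move=> L0 R; have Pp := R.1; have [n E] := Tk_order k L0 Pp.
have [Pi Ei] := Tinv_spec k L0 Pp.
have -> : Tinv k p = iter n (Tk k) p.
  by apply: (@Tk_inj k L _ _ L0 Pi (inP_iter k n Pp)); rewrite Ei -iterS E.
have Rn := angle_of_iter k n L0 R; have := angle_of_iter k n.+1 L0 R; rewrite E => RS.
have [s [sr Es]] := angle_of_slide_inv R RS.
have := angle_of_slide (s := fun l => - s l) _ Rn; rewrite sr oppr0 => /(_ erefl).
apply: angle_of_ext => j le_j i; rewrite -[in RHS](slide_opp s J j i).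
have := Es j le_j (i + - s j - - s j.+1); rewrite /slide => <-.
by set S := \sum_(l < _) _; lia.
Qed.

Lemma angle_of_Tpow (L r k : nat) (z : int) J p : (0 < L)%N -> angle_of L r J p ->
  angle_of L r (fun j i => J j i + z * (minn j.+1 k)%:Z) (Tpow k z p).
Proof.
move=> L0 R; case: z => n; first exact: angle_of_iter.
have : angle_of L r (fun j i => J j i - n.+1%:Z * (minn j.+1 k)%:Z) (iter n.+1 (Tinv k) p).
  elim: n.+1 => [|m IHm] /=.
    by apply: angle_of_ext R => j _ i; rewrite mul0r subr0.
  by apply: angle_of_ext (angle_of_Tinv k L0 IHm) => j _ i; lia.
by apply: angle_of_ext => j _ i; rewrite NegzE mulNr.
Qed.

Lemma angle_of_act (L r N : nat) (n : 'cV[int]_N) J p : (0 < L)%N -> angle_of L r J p ->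
  angle_of L r (fun j i => J j i + \sum_(k < N) n k 0 * (minn j.+1 k.+1)%:Z) (act n p).
Proof.
move=> L0 R; rewrite /act.
have E j : \sum_(k < N) n k 0 * (minn j.+1 k.+1)%:Z =
           \sum_(k <- enum 'I_N) n k 0 * (minn j.+1 k.+1)%:Z by rewrite big_enum.
apply: (@angle_of_ext L r (fun j i =>
  J j i + \sum_(k <- enum 'I_N) n k 0 * (minn j.+1 k.+1)%:Z)) => [j _ i|].
  by rewrite E.
elim: (enum 'I_N) => [|k s IHs] /=.
  by apply: angle_of_ext R => j _ i; rewrite big_nil addr0.
apply: angle_of_ext (angle_of_Tpow k.+1 (n k 0) L0 IHs) => j _ i.
by rewrite big_cons [in RHS]addrCA addrC.
Qed.

(** * The KKR map on a fundamental window *)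

Definition el (s : seq int) (i : nat) : int := nth 0 s i.

Lemma mem_el s i : (i < size s)%N -> el s i \in s.
Proof. exact: mem_nth. Qed.

Definition leZ (x y : int) : bool := x <= y.
Definition cnt (s : seq int) (t : int) : nat := count (fun x => x <= t) s.

Lemma leZ_trans : transitive leZ.
Proof. by move=> y x z; apply: le_trans. Qed.

Lemma sortZ_id s : sorted leZ s -> sortZ s = s.
Proof. by move=> S; apply: sorted_sort S; apply: leZ_trans. Qed.

Lemma cnt_le_size s t : (cnt s t <= size s)%N.
Proof. exact: count_size. Qed.

Lemma sorted_nth_le s i (t : int) : sorted leZ s -> (i < size s)%N ->
  (el s i <= t) = (i < cnt s t)%N.
Proof.
rewrite /cnt; elim: s i => // x s IHs i /= Hp lt.
have Hs := path_sorted Hp; have Hx := order_path_min leZ_trans Hp.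
have [le|gt] := boolP (x <= t).
  by case: i lt => [|i] lt; rewrite ?le //= IHs // add1n ltnS.
have -> : count (fun x => x <= t) s = 0%N.
  apply/eqP; rewrite -leqn0 leqNgt -has_count; apply/hasPn => y /(allP Hx).
  by rewrite /leZ => le_xy; move: gt le_xy; lia.
case: i lt => [|i] lt /=; first by rewrite (negbTE gt).
have /= := allP Hx _ (mem_el (lt : (i < size s)%N)); rewrite /leZ => le.
by rewrite addn0; apply/negbTE; apply: contra gt; apply: le_trans.
Qed.

Lemma sorted_nth s i j : sorted leZ s -> (i <= j < size s)%N -> el s i <= el s j.
Proof.
move=> S /andP[le_ij lt]; apply: (sorted_leq_nth leZ_trans) => //.
by rewrite inE; apply: leq_ltn_trans lt.
Qed.

Lemma cnt_le_nth s s' t : sorted leZ s -> sorted leZ s' -> size s = size s' ->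
  (forall i, (i < size s)%N -> el s i <= el s' i) -> (cnt s' t <= cnt s t)%N.
Proof.
move=> S S' E H; have := cnt_le_size s' t; case Ei: (cnt s' t) => [//|i] lt.
have lt' : (i < size s)%N by rewrite E.
by rewrite -sorted_nth_le // (le_trans (H i lt')) // sorted_nth_le ?Ei.
Qed.

Lemma cnt_leS_nth s s' t : sorted leZ s -> sorted leZ s' -> size s = size s' ->
  (forall i, (i.+1 < size s)%N -> el s i <= el s' i.+1) -> (cnt s' t <= cnt s t + 1)%N.
Proof.
move=> S S' E H; have := cnt_le_size s' t.
case Ei: (cnt s' t) => [|[|i]] lt; rewrite ?addn1 //.
have lt' : (i.+1 < size s)%N by rewrite E.
rewrite ltnS -sorted_nth_le ?(ltnW lt') // (le_trans (H i lt')) //.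
by rewrite sorted_nth_le ?Ei.
Qed.

Section Extension.
Variables (s : seq int) (L : int).
Hypotheses (S : sorted leZ s) (R : all (fun x => 0 <= x <= L) s).

Lemma rangeP i : (i < size s)%N -> 0 <= el s i <= L.
Proof. by move=> lt; apply: (allP R); apply: mem_el. Qed.

Lemma ext_gal : (0 < size s)%N -> 0 < L ->
  gal (ext s (size s) L)
    (fun t : int => (cnt s (t %% L)%Z)%:Z + (size s)%:Z * (t %/ L)%Z).
Proof.
move=> n0 L0 i t; rewrite /ext -!/(el _ _); set n := size s in n0 *.
set r := absz _; set q := ((i - 1) %/ n)%Z.
have lt : (r < n)%N by rewrite /r; lia.
have Ei : i = q * n%:Z + r%:Z + 1 by have := divz_eq (i - 1) n; rewrite /q /r; lia.
set T := (t %% L)%Z; set Q := (t %/ L)%Z.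
have Et : t = Q * L + T by exact: divz_eq.
have hT : 0 <= T < L by rewrite /T; lia.
have hc := cnt_le_size s T; have hx := sorted_nth_le T S lt; have xL := rangeP lt.
rewrite [in LHS]Et Ei {Et Ei}; clearbody T Q q.
move: hc hx xL; rewrite -/n; set x := el _ _; set c := cnt _ _ => hc hx xL.
(* Entries lie between 0 and [L], so blocks before that of [t] are counted in full and later ones
   not at all; only the block of [t] needs [cnt]. *)
have [lt1|[E|gt1]] : q < Q \/ q = Q \/ Q < q by lia.
- have -> : x + q * L <= Q * L + T by nia.
  by symmetry; nia.
- by rewrite E; lia.
have -> : (x + q * L <= Q * L + T) = false by nia.
by symmetry; nia.
Qed.

Lemma ext_nondecr : (0 < size s)%N -> forall i : int,
  ext s (size s) L i <= ext s (size s) L (i + 1).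
Proof.
move=> n0 i; rewrite /ext -!/(el _ _); set n := size s in n0 *.
have := divz_eq (i + 1 - 1) n; have := divz_eq (i - 1) n.
have := modz_succ (i - 1) n0; have -> : i - 1 + 1 = i + 1 - 1 by lia.
set r := ((i - 1) %% _)%Z; set r' := ((i + 1 - 1) %% _)%Z.
set q := ((i - 1) %/ _)%Z; set q' := ((i + 1 - 1) %/ _)%Z.
have hr : 0 <= r < n by rewrite /r; lia.
have lt : (absz r < n)%N by lia.
case: ifP => H -> E1 E2.
  have -> : q' = q by nia.
  by rewrite lerD2r; apply: sorted_nth => //; rewrite -/n; lia.
have -> : q' = q + 1 by nia.
by have := rangeP lt; have := rangeP n0; rewrite -/n absz0; nia.
Qed.

End Extension.

(* For the cut multisets of a word this is the number of 2's among the first [t] letters;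
   written as a symmetric function of the cuts, it is unaffected by the removal of common cuts. *)
Definition twos (M1 M2 : seq int) (t : int) : int :=
  \sum_(x <- M1) Num.max 0 (t - x) - \sum_(y <- M2) Num.max 0 (t - y).

Definition interlaced (M1 M2 : seq int) :=
  forall t : int, (cnt M2 t <= cnt M1 t <= cnt M2 t + 1)%N.

(** Holds for the cuts of a ballot word of length [L] and persists through the recursion. The ballot
    condition is imposed at 21-cuts, where the excess of 2's has its local maxima. *)
Record kkr_inv (L : int) (M1 M2 : seq int) : Prop := KkrInv {
  kkr_sorted1 : sorted leZ M1;
  kkr_sorted2 : sorted leZ M2;
  kkr_size : size M1 = size M2;
  kkr_range1 : all (fun x => 1 <= x <= L) M1;
  kkr_range2 : all (fun x => 1 <= x <= L) M2;
  kkr_interlaced : interlaced M1 M2;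
  kkr_disjoint : forall v, v \in M1 -> v \notin M2;
  kkr_ballot : forall y, y \in M2 -> 2 * twos M1 M2 y <= y }.

Lemma twos_nth (M1 M2 : seq int) i : sorted leZ M1 -> sorted leZ M2 -> size M1 = size M2 ->
  (forall j, (j < size M1)%N -> el M1 j <= el M2 j) ->
  (forall j, (j.+1 < size M1)%N -> el M2 j <= el M1 j.+1) ->
  (i < size M1)%N ->
  twos M1 M2 (el M2 i) = \sum_(j < i.+1) (el M2 j - el M1 j).
Proof.
move=> S1 S2 E H H' lt; rewrite /twos (big_nth 0 (r := M1)) (big_nth 0 (r := M2)) !big_mkord -E -sumrB.
under eq_bigr do rewrite -!/(el _ _).
rewrite (big_ord_widen _ (fun j => el M2 j - el M1 j) lt) [RHS]big_mkcond /=.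
apply: eq_bigr => j _; have ltj := ltn_ord j; case: ifP => le.
  have := H j ltj; have := @sorted_nth M2 j i S2; rewrite -E.
  by move=> /(_ _) h; have := h ltac:(lia); lia.
have lt_ij : (i < j)%N by lia.
have := H' i ltac:(lia); have := H j ltj.
have := @sorted_nth M1 i.+1 j S1 ltac:(lia); lia.
Qed.

Lemma size_Op1 s : size (Op1 s) = size s.
Proof. by rewrite /Op1 size_map size_iota size_sort. Qed.

Lemma size_Op2 s : size (Op2 s) = size s.
Proof. by rewrite /Op2 size_map size_iota size_sort. Qed.

Lemma nth_Op1 s i : sorted leZ s -> (i < size s)%N ->
  el (Op1 s) i = el s i - (2 * i%:Z + 1).
Proof.
move=> S lt; rewrite /el /Op1 sortZ_id // (nth_map 0%N) ?size_iota // nth_iota // add0n -/(el _ _); lia.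
Qed.

Lemma nth_Op2 s i : sorted leZ s -> (i < size s)%N ->
  el (Op2 s) i = el s i - 2 * (i%:Z + 1).
Proof.
move=> S lt; rewrite /el /Op2 sortZ_id // (nth_map 0%N) ?size_iota // nth_iota // add0n -/(el _ _); lia.
Qed.

Section Step.
Variables (L : int) (M1 M2 : seq int).
Hypothesis I : kkr_inv L M1 M2.
Let n := size M1.
Let L' : int := L - 2 * n%:Z.

Lemma kkr_lt i : (i < n)%N -> el M1 i < el M2 i.
Proof.
case: I => S1 S2 E R1 R2 il dj _ lt; have lt2 : (i < size M2)%N by rewrite -E.
rewrite lt_neqAle; apply/andP; split.
  by apply: contraNneq (dj _ (mem_el lt)) => ->; apply: mem_el.
rewrite sorted_nth_le //; have /andP[+ _] := il (el M2 i).
by apply: leq_trans; rewrite -sorted_nth_le.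
Qed.

Lemma kkr_ltS i : (i.+1 < n)%N -> el M2 i < el M1 i.+1.
Proof.
case: I => S1 S2 E R1 R2 il dj _ lt; have lt2 : (i < size M2)%N by rewrite -E ltnW.
rewrite lt_neqAle; apply/andP; split.
  by apply: contraNneq (dj _ (mem_el lt)) => <-; apply: mem_el.
rewrite sorted_nth_le //; have /andP[_] := il (el M1 i.+1).
have : (i.+1 < cnt M1 (el M1 i.+1))%N by rewrite -sorted_nth_le.
by rewrite addn1 => lt' /(leq_trans lt').
Qed.

Let N1 := Op1 M1.
Let N2 := Op2 M2.

Lemma op_nth i : (i < n)%N -> el N1 i = el M1 i - (2 * i%:Z + 1) /\
  el N2 i = el M2 i - 2 * (i%:Z + 1).
Proof.
case: I => S1 S2 E _ _ _ _ _ lt.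
by rewrite nth_Op1 // nth_Op2 // -E.
Qed.

Lemma op_le i : (i < n)%N -> el N1 i <= el N2 i.
Proof. by move=> lt; have [-> ->] := op_nth lt; have := kkr_lt lt; lia. Qed.

Lemma op_leS i : (i.+1 < n)%N -> el N2 i <= el N1 i.+1.
Proof.
move=> lt; have [-> _] := op_nth lt; have [_ ->] := op_nth (ltnW lt).
by have := kkr_ltS lt; lia.
Qed.

Lemma sorted_op1 : sorted leZ N1.
Proof.
apply/(sortedP 0) => i; rewrite size_Op1 => lt; rewrite /leZ.
by apply: le_trans (op_leS lt); apply: op_le; apply: ltnW.
Qed.

Lemma sorted_op2 : sorted leZ N2.
Proof.
apply/(sortedP 0) => i; rewrite size_Op2 -(kkr_size I) => lt; rewrite /leZ.
by apply: le_trans (op_leS lt) _; apply: op_le.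
Qed.

Lemma op_range i : (i < n)%N -> 0 <= el N1 i /\ el N2 i <= L'.
Proof.
move=> lt; have Sz := kkr_size I.
have N2n : size N2 = n by rewrite size_Op2 -Sz.
split.
  have lt0 : (0 < n)%N by apply: leq_ltn_trans lt.
  apply: le_trans (sorted_nth sorted_op1 (i := 0%N) (j := i) _); last by rewrite size_Op1.
  have [-> _] := op_nth lt0; have := allP (kkr_range1 I) _ (mem_el lt0); lia.
have ltn : (n.-1 < n)%N by lia.
apply: le_trans (sorted_nth sorted_op2 (i := i) (j := n.-1) _) _; first by rewrite N2n; lia.
have [_ ->] := op_nth ltn; rewrite /L'.
have lt2 : (n.-1 < size M2)%N by rewrite -Sz.
have := allP (kkr_range2 I) _ (mem_el lt2); lia.
Qed.

Lemma op_all1 : all (fun x => 0 <= x <= L') N1.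
Proof.
apply/(all_nthP 0) => i; rewrite size_Op1 -/(el _ _) => lt.
by have := op_range lt; have := op_le lt; lia.
Qed.

Lemma op_all2 : all (fun x => 0 <= x <= L') N2.
Proof.
apply/(all_nthP 0) => i; rewrite size_Op2 -(kkr_size I) -/(el _ _) => lt.
by have := op_range lt; have := op_le lt; lia.
Qed.

Lemma size_op : size N1 = size N2.
Proof. by rewrite size_Op1 size_Op2 (kkr_size I). Qed.

Lemma op_interlaced : interlaced N1 N2.
Proof.
move=> t; apply/andP; split.
  apply: (cnt_le_nth _ sorted_op1 sorted_op2 size_op) => i.
  by rewrite size_Op1; apply: op_le.
apply: (cnt_leS_nth _ sorted_op2 sorted_op1 (esym size_op)) => i.
by rewrite size_Op2 -(kkr_size I); apply: op_leS.
Qed.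

Lemma op_twos i : (i < n)%N ->
  twos N1 N2 (el N2 i) = \sum_(j < i.+1) (el N2 j - el N1 j).
Proof.
move=> lt; apply: (twos_nth sorted_op1 sorted_op2 size_op); rewrite size_Op1 //.
  exact: op_le.
exact: op_leS.
Qed.

(** Each of the first [i + 1] runs of 2's loses one letter while the cut moves left by
    [2 * (i + 1)], so both sides of the inequality drop equally. *)
Lemma op_ballot y : y \in N2 -> 2 * twos N1 N2 y <= y.
Proof.
move=> /(nthP 0) [i]; rewrite size_Op2 -(kkr_size I) -/(el _ _) => lt <-; rewrite op_twos //.
have E : \sum_(j < i.+1) (el N2 j - el N1 j) =
         \sum_(j < i.+1) (el M2 j - el M1 j) - i.+1%:Z.
  have -> : i.+1%:Z = \sum_(j < i.+1) 1 :> int by rewrite sumr_const card_ord natz.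
  rewrite -sumrB; apply: eq_bigr => j _.
  have ltj : (j < n)%N by have := ltn_ord j; lia.
  by have [-> ->] := op_nth ltj; lia.
have lt2 : (i < size M2)%N by rewrite -(kkr_size I).
have := kkr_ballot I (mem_el lt2).
rewrite (twos_nth (kkr_sorted1 I) (kkr_sorted2 I) (kkr_size I)) //.
- by have [_ ->] := op_nth lt; rewrite E; lia.
- by move=> j ltj; apply: ltW; apply: kkr_lt.
- by move=> j ltj; apply: ltW; apply: kkr_ltS.
Qed.

(* By the ballot condition a 12-cut at the origin meets a 21-cut there. *)
Lemma op_zero : (cnt N1 0 <= cnt N2 0)%N.
Proof.
case Ec: (cnt N1 0) => [//|i].
have lt : (i < n)%N by rewrite /n -(size_Op1 M1) -Ec cnt_le_size.
have lt2 : (i < size N2)%N by rewrite -size_op size_Op1.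
rewrite -sorted_nth_le ?sorted_op2 //.
have := op_ballot (mem_el lt2); rewrite op_twos //.
have Z j : (j <= i)%N -> el N1 j = 0.
  move=> le; have ltj : (j < n)%N by lia.
  have := op_range ltj; have : el N1 j <= 0; last by lia.
  by rewrite sorted_nth_le ?sorted_op1 ?size_Op1 // Ec.
rewrite big_ord_recr /= (Z i) //.
set S := (X in 2 * (X + _)); have : 0 <= S; last by lia.
rewrite /S; apply: sumr_ge0 => j _; have ltj : (j < n)%N by have := ltn_ord j; lia.
by have := op_le ltj; lia.
Qed.

End Step.

(** * Splitting off the common cuts *)

Lemma count_mem_minter s t (v : int) :
  count_mem v (minter s t) = minn (count_mem v s) (count_mem v t).
Proof.
elim: s t => [|x s IHs] t /=; first by rewrite min0n.
case: ifP => xt /=; rewrite IHs.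
  rewrite (permP (perm_to_rem xt)) /=; lia.
have [<-|ne] /= := eqVneq x v; last by rewrite !add0n.
by have /count_memPn -> : x \notin t by [rewrite xt]; rewrite !minn0.
Qed.

Lemma count_mem_mdiff s t (v : int) :
  count_mem v (mdiff s t) = (count_mem v s - count_mem v t)%N.
Proof.
elim: t => [|x t IHt] /=; first by rewrite subn0.
rewrite count_rem IHt; have [E|ne] /= := eqVneq x v.
  rewrite E eqxx andbT add1n subnS; case: (boolP (v \in _)) => [_|/count_memPn].
    by rewrite subn1.
  by rewrite IHt => ->.
by rewrite (negbTE ne) andbF subn0.
Qed.

Lemma subseq_minter s t : subseq (minter s t) s.
Proof.
elim: s t => //= x s IHs t; case: ifP => _; first by rewrite eqxx.
by apply: subseq_trans (IHs _) (subseq_cons _ _).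
Qed.

Lemma subseq_mdiff s t : subseq (mdiff s t) s.
Proof. by elim: t => //= x t IHt; apply: subseq_trans (rem_subseq _ _) IHt. Qed.

Lemma perm_mdiff s S : (forall v : int, (count_mem v S <= count_mem v s)%N) ->
  perm_eq s (mdiff s S ++ S).
Proof.
move=> H; apply/allP => v _ /=.
by rewrite count_cat count_mem_mdiff subnK.
Qed.

Section Remove.
Variables (L : int) (M1 M2 : seq int).
Hypothesis I : kkr_inv L M1 M2.
Let n := size M1.
Let L' : int := L - 2 * n%:Z.
Let N1 := Op1 M1.
Let N2 := Op2 M2.
Let S := minter N1 N2.
Let P1 := mdiff N1 S.
Let P2 := mdiff N2 S.

Lemma remove_perm1 : perm_eq N1 (P1 ++ S).
Proof. by apply: perm_mdiff => v; rewrite count_mem_minter geq_minl. Qed.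

Lemma remove_perm2 : perm_eq N2 (P2 ++ S).
Proof. by apply: perm_mdiff => v; rewrite count_mem_minter geq_minr. Qed.

Lemma remove_cnt1 t : cnt N1 t = (cnt P1 t + cnt S t)%N.
Proof. by rewrite /cnt (permP remove_perm1) count_cat. Qed.

Lemma remove_cnt2 t : cnt N2 t = (cnt P2 t + cnt S t)%N.
Proof. by rewrite /cnt (permP remove_perm2) count_cat. Qed.

Lemma remove_size1 : size N1 = (size P1 + size S)%N.
Proof. by rewrite (perm_size remove_perm1) size_cat. Qed.

Lemma remove_size2 : size N2 = (size P2 + size S)%N.
Proof. by rewrite (perm_size remove_perm2) size_cat. Qed.

Lemma remove_twos t : twos P1 P2 t = twos N1 N2 t.
Proof.
rewrite /twos [in RHS](perm_big _ remove_perm1) [in X in _ = _ - X](perm_big _ remove_perm2) /=.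
by rewrite !big_cat /= opprD addrACA subrr addr0.
Qed.

Lemma sorted_meet : sorted leZ S.
Proof. exact: subseq_sorted leZ_trans _ _ (subseq_minter _ _) (sorted_op1 I). Qed.

Lemma meet_range : all (fun x => 0 <= x <= L') S.
Proof. by apply/allP => x /(mem_subseq (subseq_minter _ _)) /(allP (op_all1 I)). Qed.

(** At the origin there are at least as many 21-cuts as 12-cuts, so the intersection takes all of
    the latter and the positions that remain start at 1 again. *)
Lemma remove_zero1 : cnt P1 0 = 0%N.
Proof.
apply/eqP; rewrite -leqn0 leqNgt -has_count; apply/hasPn => x xP; apply/negP => le0.
have x0 : x = 0.
  by have := allP (op_all1 I) _ (mem_subseq (subseq_mdiff _ _) xP); lia.
have Z (s : seq int) : all (fun x => 0 <= x <= L') s -> cnt s 0 = count_mem x s.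
  by move=> R; apply: eq_in_count => y /(allP R) /=; rewrite x0; lia.
have := op_zero I; rewrite !Z ?(op_all1 I) ?(op_all2 I) // => le.
by move: xP; rewrite -has_pred1 has_count count_mem_mdiff count_mem_minter (minn_idPl le) subnn.
Qed.

Lemma remove_inv : kkr_inv L' P1 P2.
Proof.
have il : interlaced P1 P2.
  by move=> t; have := op_interlaced I t; rewrite remove_cnt1 remove_cnt2; lia.
have pos (M : seq int) : all (fun x => 0 <= x <= L') M -> cnt M 0 = 0%N ->
    all (fun x => 1 <= x <= L') M.
  move=> R Z; apply/allP => x xM; have := allP R _ xM => /= h.
  suff : ~~ (x <= 0) by lia.
  have : ~~ has (fun x : int => x <= 0) M by rewrite has_count [count _ _]Z.
  by move/hasPn => /(_ _ xM).
split=> //.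
- exact: subseq_sorted leZ_trans _ _ (subseq_mdiff _ _) (sorted_op1 I).
- exact: subseq_sorted leZ_trans _ _ (subseq_mdiff _ _) (sorted_op2 I).
- by have := size_op I; rewrite remove_size1 remove_size2 => /addIn.
- apply: pos remove_zero1.
  by apply/allP => x /(mem_subseq (subseq_mdiff _ _)) /(allP (op_all1 I)).
- apply: pos; last by have := il 0; rewrite remove_zero1; lia.
  by apply/allP => x /(mem_subseq (subseq_mdiff _ _)) /(allP (op_all2 I)).
- move=> v; rewrite -!has_pred1 !has_count !count_mem_mdiff !count_mem_minter; lia.
move=> y yP; rewrite remove_twos; apply: (op_ballot I).
exact: mem_subseq (subseq_mdiff _ _) _ yP.
Qed.

(** One turn of the window advances the index by [n] and so subtracts a further [2 * n]; this is why
    the quasi-period drops to [L - 2 * n]. *)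
Lemma ext_op1 (i : int) : (0 < n)%N -> ext N1 n L' i = ext M1 n L i - (2 * i - 1).
Proof.
move=> n0; rewrite /ext -!/(el _ _); set r := absz _; set q := ((i - 1) %/ n)%Z.
have lt : (r < n)%N by rewrite /r; lia.
have Ei : i = q * n%:Z + r%:Z + 1 by have := divz_eq (i - 1) n; rewrite /q /r; lia.
have [-> _] := op_nth I lt.
by clearbody r q; rewrite [in RHS]Ei /L'; lia.
Qed.

Lemma ext_op2 (i : int) : (0 < n)%N -> ext N2 n L' i = ext M2 n L i - 2 * i.
Proof.
move=> n0; rewrite /ext -!/(el _ _); set r := absz _; set q := ((i - 1) %/ n)%Z.
have lt : (r < n)%N by rewrite /r; lia.
have Ei : i = q * n%:Z + r%:Z + 1 by have := divz_eq (i - 1) n; rewrite /q /r; lia.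
have [_ ->] := op_nth I lt.
by clearbody r q; rewrite [in RHS]Ei /L'; lia.
Qed.

End Remove.

Lemma inner_index f M1 M2 i A B i' : inner f M1 M2 i = Some (A, B, i') -> (i <= i')%N.
Proof.
elim: f M1 M2 i => [|f IHf] M1 M2 i /=; case: ifP => _ //; try by case=> _ _ <-.
by move/IHf/ltnW.
Qed.

(** Disjointness rules out stopping at once, and the recorded count 1 then means exactly one
    application of the operations. *)
Lemma inner_one L f M1 M2 A B : kkr_inv L M1 M2 -> inner f M1 M2 0 = Some (A, B, 1%N) ->
  [/\ A = Op1 M1, B = Op2 M2 & minter A B != [::]].
Proof.
move=> I.
have D : minter M1 M2 = [::].
  case E: (minter M1 M2) => [//|x s].
  have : (0 < count_mem x (minter M1 M2))%N by rewrite -has_count has_pred1 E mem_head.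
  rewrite count_mem_minter leq_min -!has_count !has_pred1.
  by case/andP => /(kkr_disjoint I) /negP.
case: f => [|f] /=; rewrite D //=.
case: f => [|f] /=; case: ifP => ne //; try by case=> <- <-.
by move/inner_index.
Qed.

Definition records_vac (L : int) (recs : seq (seq int * nat)) (j : nat) : int :=
  L - 2 * (\sum_(k < size recs) minn j.+1 k.+1 * size (nth ([::], 0%N) recs k).1)%N%:Z.

Definition records_angle (L : int) (recs : seq (seq int * nat)) (j : nat) (i : int) : int :=
  let s := (nth ([::], 0%N) recs j).1 in ext s (size s) (records_vac L recs j) i.

Lemma outer_nil f M1 M2 : outer f M1 M2 = Some [::] -> M1 = [::] /\ M2 = [::].
Proof.
case: f => [|f] /=; case: ifP => [/andP[/eqP-> /eqP->] //|_] //.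
by case: (inner _ _ _ _) => // -[[A B] j]; case: (outer _ _ _).
Qed.

Lemma outer_cons L f M1 M2 S recs : kkr_inv L M1 M2 ->
  outer f M1 M2 = Some ((S, 1%N) :: recs) ->
  [/\ S = minter (Op1 M1) (Op2 M2), (0 < size S)%N
    & exists f', outer f' (mdiff (Op1 M1) S) (mdiff (Op2 M2) S) = Some recs].
Proof.
move=> I; case: f => [|f] /=; case: ifP => // _.
case Ei: (inner _ _ _ _) => [[[A B] j]|] //; case Eo: (outer _ _ _) => [r|] //.
case=> ES Ej Er; rewrite Ej in Ei; have [EA EB ne] := inner_one I Ei.
rewrite EA EB in ES ne Eo; split; first by rewrite ES.
  by rewrite -ES lt0n size_eq0.
by exists f; rewrite -ES -Er.
Qed.

Definition records_size (recs : seq (seq int * nat)) : nat :=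
  \sum_(k < size recs) size (nth ([::], 0%N) recs k).1.

Lemma records_size_cons r recs :
  records_size (r :: recs) = (size r.1 + records_size recs)%N.
Proof. by rewrite /records_size /= big_ord_recl. Qed.

Lemma records_vac0 L recs : records_vac L recs 0 = L - 2 * (records_size recs)%:Z.
Proof.
rewrite /records_vac /records_size; congr (_ - 2 * Posz _).
by apply: eq_bigr => k _; rewrite minnSS min0n mul1n.
Qed.

(** Shortening every soliton by one, and the system by twice their number, preserves vacancy
    numbers, as [minn j.+2 k.+2 = minn j.+1 k.+1 + 1]. *)
Lemma records_vacS L r recs j : records_vac L (r :: recs) j.+1 =
  records_vac (L - 2 * (records_size (r :: recs))%:Z) recs j.
Proof.
rewrite records_size_cons /records_vac /= big_ord_recl /= minnSS minn0 mul1n.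
have -> : (\sum_(k < size recs) minn j.+2 (bump 0 k).+1 * size (nth ([::], 0) recs k).1 =
  records_size recs + \sum_(k < size recs) minn j.+1 k.+1 * size (nth ([::], 0) recs k).1)%N.
  by rewrite /records_size -big_split; apply: eq_bigr => k _; rewrite minnSS mulSn.
by set A := records_size _; set B := bigop _ _ _; lia.
Qed.

(** Under quasi-periodic extension each round of the recursion becomes one level of [tower], the
    removal of [S] turning into a sum of counting functions. *)
Lemma kkr_tower recs fuel L M1 M2 : kkr_inv L M1 M2 -> (0 < size recs)%N ->
  outer fuel M1 M2 = Some recs -> all (fun r => r.2 == 1%N) recs ->
  [/\ (0 < size M1)%N, all (fun r => sorted leZ r.1) recs, size M1 = records_size recs &
      tower (size recs).-1 (records_angle L recs) (ext M1 (size M1) L) (ext M2 (size M1) L)].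
Proof.
elim: recs fuel L M1 M2 => // -[S i] recs IHr fuel L M1 M2 I _ E /= /andP[/eqP /= i1 all1].
rewrite {i}i1 in E *; have [ES S0 [f Eo]] := outer_cons I E; move: Eo; rewrite ES => Eo.
have I' := remove_inv I; have sz1 := remove_size1 M1 M2.
have szE := size_Op1 M1; have szO := size_op I.
have SS := sorted_meet I; have RS := meet_range I.
rewrite -ES in Eo I' sz1 SS RS *.
have n0 : (0 < size M1)%N by rewrite -szE sz1; lia.
have E0 : size M1 = records_size ((S, 1%N) :: recs) ->
    records_angle L ((S, 1%N) :: recs) 0 =1 ext S (size S) (L - 2 * (size M1)%:Z).
  by move=> En i; rewrite /records_angle /= records_vac0 -En.
case: recs => [|r recs] in IHr E Eo all1 E0 *.
  (* After the last record nothing is left over, so both operated multisets equal [S]: the base case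
     of [tower]. *)
  have [P1 P2] := outer_nil Eo.
  have En : size M1 = records_size [:: (S, 1%N)].
    by rewrite /records_size big_ord1 /= -szE sz1 P1.
  have N1 : Op1 M1 = S.
    apply: (sorted_eq leZ_trans _ (sorted_op1 I) SS).
      by move=> x y; rewrite /leZ; lia.
    by have := remove_perm1 M1 M2; rewrite -ES P1.
  have N2 : Op2 M2 = S.
    apply: (sorted_eq leZ_trans _ (sorted_op2 I) SS).
      by move=> x y; rewrite /leZ; lia.
    by have := remove_perm2 M1 M2; rewrite -ES P2.
  have nS : size S = size M1 by rewrite -N1.
  split=> //; first by rewrite SS.
  split=> j; rewrite ?(E0 En).
  - exact: ext_nondecr.
  - by have := ext_op1 I j n0; rewrite N1 nS; lia.
  - by have := ext_op2 I j n0; rewrite N2 nS; lia.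
have [n1 sorted_recs Er T] := IHr _ _ _ _ I' isT Eo all1.
have En : size M1 = records_size [:: (S, 1%N), r & recs].
  by rewrite records_size_cons -Er -szE sz1 addnC.
split=> //; first by rewrite /= SS.
set L' := L - 2 * (size M1)%:Z in T I' E0 RS.
have sz2 := remove_size2 M1 M2; rewrite -ES in sz2.
have L0 : 0 < L'.
  have := allP (kkr_range1 I') _ (mem_el n1); lia.
have w (s : seq int) : all (fun x => 1 <= x <= L') s -> all (fun x => 0 <= x <= L') s.
  by apply: sub_all => x; lia.
have g1 := ext_gal (kkr_sorted1 I') (w _ (kkr_range1 I')) n1 L0.
have n2 : (0 < size (mdiff (Op2 M2) S))%N by rewrite -(kkr_size I').
have g2 := ext_gal (kkr_sorted2 I') (w _ (kkr_range2 I')) n2 L0.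
have gS := ext_gal SS RS S0 L0.
have gN1 := ext_gal (sorted_op1 I) (op_all1 I) _ L0.
have gN2 := ext_gal (sorted_op2 I) (op_all2 I) _ L0.
rewrite -szO szE in gN1 gN2.
eexists _, _, _, _, _; split.
- apply: tower_ext T => // j _ i; rewrite /records_angle /=.
  by rewrite records_vacS -En.
- split; [by apply: gal_ext gS => // i; rewrite E0 | exact: g1 |].
  by rewrite -(kkr_size I') in g2; exact: g2.
- apply: gal_ext (gN1 n0) => i /=; first by rewrite (ext_op1 I).
  have := remove_cnt1 M1 M2 (i %% L')%Z; rewrite -ES => ->.
  by rewrite -/L' -szE sz1 !PoszD mulrDl addrACA.
apply: gal_ext (gN2 n0) => i /=; first by rewrite (ext_op2 I).
have := remove_cnt2 M1 M2 (i %% L')%Z; rewrite -ES => ->.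
by rewrite -/L' -szE szO sz2 -(kkr_size I') !PoszD mulrDl addrACA.
Qed.

(** * The cuts of a ballot word *)

Lemma sum_posS (M : seq int) (t : int) :
  \sum_(x <- M) Num.max 0 (t + 1 - x) = \sum_(x <- M) Num.max 0 (t - x) + (cnt M t)%:Z.
Proof.
rewrite /cnt; elim: M => [|x M IHM]; first by rewrite !big_nil.
rewrite !big_cons IHM /=; set S := (X in _ + (X + _)); set c := count _ _.
by case: (leP x t) => le; lia.
Qed.

Lemma twosS M1 M2 (t : int) :
  twos M1 M2 (t + 1) = twos M1 M2 t + ((cnt M1 t)%:Z - (cnt M2 t)%:Z).
Proof. by rewrite /twos !sum_posS opprD addrACA. Qed.

Lemma iota1S t : iota 1 t.+1 = iota 1 t ++ [:: t.+1].
Proof. by have := iotaD 1 t 1; rewrite addn1 add1n. Qed.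

Section Word.
Variables (p : seq nat).
Hypothesis letters : all (fun b => (b == 1%N) || (b == 2%N)) p.
Let L := size p.
Let p' := p ++ [:: 1%N].

Definition cut (x y : nat) (j : nat) : bool :=
  (nth 0%N p' j.-1 == x) && (nth 0%N p' j == y).

Lemma MsetE x y : Mset x y p = [seq Posz j | j <- iota 1 L & cut x y j].
Proof. by []. Qed.

Lemma size_Mset x y : size (Mset x y p) = count (cut x y) (iota 1 L).
Proof. by rewrite MsetE size_map size_filter. Qed.

Lemma cnt_Mset x y (t : int) :
  cnt (Mset x y p) t = count (cut x y) (iota 1 (if t < 0 then 0%N else minn (absz t) L)).
Proof.
set m := if _ then _ else _; rewrite MsetE /cnt count_map count_filter.
have -> : L = (m + (L - m))%N by rewrite /m; case: ifP; lia.
rewrite iotaD count_cat -[RHS]addn0; congr (_ + _)%N.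
  apply: eq_in_count => j; rewrite mem_iota /= => h.
  have -> // : (Posz j <= t) = true by move: h; rewrite /m; case: ifP; lia.
apply/eqP; rewrite -leqn0 leqNgt -has_count; apply/hasPn => j; rewrite mem_iota /= => h.
have -> // : (Posz j <= t) = false by move: h; rewrite /m; case: ifP; lia.
Qed.

Lemma letter'P t : (t <= L)%N -> (nth 0%N p' t == 1%N) || (nth 0%N p' t == 2%N).
Proof.
rewrite /p' nth_cat; case: ltnP => [lt _|ge le]; first exact: (letterP letters lt).
by have -> : (t - size p)%N = 0%N by [rewrite /L in le; lia].
Qed.

Hypothesis first1 : nth 0%N p' 0 = 1%N.

(** The two kinds of cut alternate, beginning with a 12-cut as the word begins with 1; a surplus of
    one means that the current letter is a 2. *)
Lemma cut_diff t : (t <= L)%N -> count (cut 1 2) (iota 1 t) =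
  (count (cut 2 1) (iota 1 t) + (nth 0%N p' t == 2%N))%N.
Proof.
elim: t => [|t IHt] lt; first by rewrite first1.
rewrite iota1S !count_cat IHt 1?ltnW // /= /cut /= !addn0.
by have := letter'P (ltnW lt); have := letter'P lt; lia.
Qed.

Lemma cnt_Mset_diff (t : int) : cnt (Mset 1 2 p) t =
  (cnt (Mset 2 1 p) t + ((0 <= t)%R && (nth 0%N p' (minn (absz t) L) == 2%N)))%N.
Proof. by rewrite !cnt_Mset; case: ltP => _ /=; rewrite ?cut_diff ?geq_minr. Qed.

Lemma twos_word t : (t <= L)%N ->
  twos (Mset 1 2 p) (Mset 2 1 p) t%:Z = (count (pred1 2%N) (take t p))%:Z.
Proof.
elim: t => [|t IHt] lt.
  rewrite take0 /= /twos !big1_seq ?subrr // => x /andP[_];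
  by rewrite MsetE => /mapP[j]; rewrite mem_filter mem_iota => h ->; lia.
have -> : t.+1%:Z = t%:Z + 1 by lia.
rewrite twosS IHt 1?ltnW // cnt_Mset_diff.
rewrite (take_nth 0%N lt) -cats1 count_cat /=.
have -> : minn (absz t%:Z) L = t by lia.
by rewrite /p' nth_cat lt; lia.
Qed.

Hypothesis bal : ballot p.

Lemma kkr_inv_word : kkr_inv L%:Z (Mset 1 2 p) (Mset 2 1 p).
Proof.
have srt x y : sorted leZ (Mset x y p).
  rewrite MsetE sorted_map; apply: sorted_filter; first by move=> a b c /=; apply: leZ_trans.
  by apply: sub_sorted (iota_sorted 1 L) => a b; rewrite /leZ /=; lia.
have rng x y : all (fun u => 1 <= u <= L%:Z) (Mset x y p).
  apply/allP => u; rewrite MsetE => /mapP[j]; rewrite mem_filter mem_iota => h ->.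
  by move: h; case/andP => _; lia.
split=> //.
- by rewrite !size_Mset cut_diff // /p' nth_cat ltnn subnn addn0.
- move=> t; rewrite cnt_Mset_diff; lia.
- move=> v; rewrite !MsetE => /mapP[j]; rewrite mem_filter => /andP[/andP[/eqP h _] _] ->.
  apply/negP => /mapP[i]; rewrite mem_filter => /andP[/andP[/eqP h' _] _] [E].
  by move: h'; rewrite -E h.
move=> y; rewrite MsetE => /mapP[j]; rewrite mem_filter mem_iota => /andP[_ /andP[j1 jL]] ->.
have le : (j <= L)%N by lia.
rewrite twos_word //; have := bal le.
have := @count_letters (take j p); rewrite size_take_min.
have -> : all (fun b => (b == 1%N) || (b == 2%N)) (take j p).
  by apply/allP => b /mem_take /(allP letters).
move=> /(_ isT); move: le; rewrite /L; lia.
Qed.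

End Word.

Lemma angle_of_kkr L p recs : inP L p -> ballot p -> (0 < size recs)%N ->
  kkr_records p recs -> all (fun r => r.2 == 1%N) recs ->
  [/\ (0 < L)%N, all (fun r => sorted leZ r.1) recs &
  angle_of L (size recs).-1 (records_angle L recs) p].
Proof.
move=> Pp bal r0 [fuel E] all1; have [sz lets _] := inP_all Pp.
(* A nonempty ballot path begins with 1; for the empty path the appended letter is read. *)
have f1 : nth 0%N (p ++ [:: 1%N]) 0 = 1%N.
  case Ep: p lets => [//|b q] /= /andP[/orP[/eqP -> //|/eqP Eb] _].
  by have := bal 1%N; rewrite Ep Eb /= => /(_ isT); rewrite take0.
have I := kkr_inv_word lets f1 bal; rewrite sz in I.
have [n0 srt En T] := kkr_tower I r0 E all1.
have L0 : 0 < L%:Z by have := allP (kkr_range1 I) _ (mem_el n0); lia.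
split=> //; split=> //.
have w (s : seq int) : all (fun x => 1 <= x <= L%:Z) s -> all (fun x => 0 <= x <= L%:Z) s.
  by apply: sub_all => x; lia.
have n0' : (0 < size (Mset 2 1 p))%N by rewrite -(kkr_size I).
have g1 := ext_gal (kkr_sorted1 I) (w _ (kkr_range1 I)) n0 L0.
have g2 := ext_gal (kkr_sorted2 I) (w _ (kkr_range2 I)) n0' L0.
rewrite -(kkr_size I) in g2.
eexists _, _, _, _; split; [exact: T | exact: g1 | exact: g2 |].
move=> t; rewrite /word cnt_Mset_diff //.
have h : 0 <= (t %% L%:Z)%Z < L%:Z by lia.
rewrite sz; have -> : minn (absz (t %% L%:Z)%Z) L = absz (t %% L%:Z)%Z by lia.
rewrite nth_cat sz; have -> : (absz (t %% L%:Z)%Z < L)%N by lia.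
rewrite /pword sz; case: (_ == 2%N); lia.
Qed.

(** * The stabilizer of a path *)

(* The translations [(s, c)] with [J (i + s) = J i + c] form a cyclic group, and maximality of [a]
   makes [(m / a, q / a)] a generator. *)
Lemma symmetry_generator (m a : nat) (q : int) (J : int -> int) :
  (0 < m)%N -> (0 < a)%N -> (a %| m)%N -> (a%:Z %| q)%Z -> Jbar_alpha m%:Z q a J ->
  forall s c : int, (forall i, J (i + s) = J i + c) <->
    exists v : int, s = v * (m %/ a)%N%:Z /\ c = v * (q %/ a%:Z)%Z.
Proof.
move=> m0 a0 /dvdnP [u Em] /dvdzP [b Eq] [[mono per] maxa].
have Em' : (m %/ a = u)%N by rewrite Em mulnK.
have Eq' : (q %/ a%:Z)%Z = b by rewrite Eq mulzK //; lia.
rewrite divz_nat Em' Eq' in per; rewrite Em' Eq'.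
have trans_mul (s c v : int) : (forall i, J (i + s) = J i + c) ->
    forall i : int, J (i + v * s) = J i + v * c.
  move=> H i; suff <- : J (i + v * s) - v * c = J i by rewrite subrK.
  rewrite (int_const (f := fun v => J (i + v * s) - v * c)) ?mul0r ?addr0 ?subr0 // => w.
  by rewrite !mulrDl !mul1r addrA H opprD addrACA subrr addr0.
move=> s c; split; last by case=> v [-> ->]; apply: trans_mul.
move=> H; have u0 : (0 < u)%N by move: m0; rewrite Em; case: (u).
(* By Bezout the gcd [g] of [u] and [s] is again the index part of a translation. If [e = u / g]
   exceeded 1, then [a * e] would be a larger common divisor with symmetry, against maximality. *)
have [x [y Eg]] := Bezoutz u%:Z s.
set g := gcdz _ _ in Eg.
have Hg (i : int) : J (i + g) = J i + (x * b + y * c).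
  by rewrite -Eg addrA (trans_mul _ _ y H) (trans_mul _ _ x per) addrA.
have /dvdzP [e Eu] : (g %| u%:Z)%Z by apply: dvdz_gcdl.
have /dvdzP [f Es] : (g %| s)%Z by apply: dvdz_gcdr.
have g0 : 0 < g.
  have : 0 <= g by []; have : g <> 0 by move=> z; move: Eu; rewrite z mulr0; lia.
  lia.
have e0 : 0 < e by nia.
have Eb : b = e * (x * b + y * c).
  by have := per 0; have := trans_mul _ _ e Hg 0; rewrite -Eu => ->; lia.
have Ec : c = f * (x * b + y * c).
  by have := H 0; have := trans_mul _ _ f Hg 0; rewrite -Es => ->; lia.
have [e1|e1] : e = 1 \/ 1 < e by lia.
  by exists f; rewrite Eb Eu e1 !mul1r.
have ae : (a * absz e)%N%:Z = a%:Z * e by rewrite PoszM; lia.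
have ae0 : (a * absz e)%N%:Z != 0 by rewrite ae; nia.
have Em2 : m%:Z = g * (a * absz e)%N%:Z.
  by rewrite ae Em PoszM Eu; ring.
have Eq2 : q = (x * b + y * c) * (a * absz e)%N%:Z.
  by rewrite ae Eq {1}Eb; ring.
case: (maxa (a * absz e)%N).
- nia.
- by apply/dvdzP; exists g.
- by apply/dvdzP; exists (x * b + y * c).
by rewrite {1}Em2 {1}Eq2 !mulzK.
Qed.

Lemma telescope_from (s : nat -> int) (l N : nat) : (l <= N)%N ->
  \sum_(k < N) (if (l <= k)%N then s k - s k.+1 else 0) = s l - s N.
Proof.
elim: N => [|N IHN]; first by rewrite leqn0 big_ord0 => /eqP ->; rewrite subrr.
rewrite leq_eqVlt => /predU1P [->|le]; rewrite big_ord_recr /=.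
  by rewrite ltnn subrr addr0 big1 // => k _; case: ifP => //; have := ltn_ord k; lia.
by rewrite IHN // -ltnS le addrA subrK.
Qed.

(** Write [s l] as the sum of the differences from [l] on; the [k]-th difference then occurs for
    [minn j.+1 k.+1] values of [l]. *)
Lemma sum_min_diff (s : nat -> int) (N j : nat) : s N = 0 -> (j < N)%N ->
  \sum_(l < j.+1) s l = \sum_(k < N) (minn j.+1 k.+1)%:Z * (s k - s k.+1).
Proof.
move=> sN; elim: j => [|j IHj] lt.
  rewrite big_ord1 /=; have := telescope_from s (leq0n N); rewrite sN subr0 => <-.
  by apply: eq_bigr => k _; rewrite minnSS min0n mul1r.
rewrite big_ord_recr /= IHj 1?ltnW //.
have := telescope_from s (ltnW lt); rewrite sN subr0 => <-.
rewrite -big_split; apply: eq_bigr => k _ /=.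
have -> : (minn j.+2 k.+1)%:Z = (minn j.+1 k.+1)%:Z + (if (j < k)%N then 1 else 0).
  by case: ifP; lia.
by rewrite mulrDl; case: ifP => _; rewrite ?mul1r ?mul0r.
Qed.

Lemma sum_min_mul (rho : nat -> int) (N : nat) :
  exists s : nat -> int, [/\ s N = 0, forall l, (l < N)%N -> s l - s l.+1 = rho l &
    forall j, (j < N)%N -> \sum_(l < j.+1) s l = \sum_(k < N) (minn j.+1 k.+1)%:Z * rho k].
Proof.
pose s l := \sum_(k < N) (if (l <= k)%N then rho k else 0).
have sN : s N = 0 by rewrite /s big1 // => k _; rewrite leqNgt ltn_ord.
have sS l : (l < N)%N -> s l - s l.+1 = rho l.
  move=> ltl; rewrite /s -sumrB (bigD1 (Ordinal ltl)) //= leqnn ltnn subr0 big1 ?addr0 //.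
  move=> k ne; have {}ne : (k : nat) != l by apply: contraNneq ne => E; apply/eqP/val_inj.
  by have -> : (l < k)%N = (l <= k)%N by [lia]; rewrite subrr.
exists s; split=> // j lt; rewrite (sum_min_diff sN) //.
by apply: eq_bigr => k _; rewrite sS.
Qed.

Lemma scan_ones (T : Type) (recs : seq (T * nat)) (a n : nat) :
  scanl (fun acc r => (acc + r.2)%N) a recs = iota a.+1 n -> all (fun r => r.2 == 1%N) recs.
Proof.
elim: recs a n => //= r recs IHr a [|n] //= [E1 E2]; rewrite E1 in E2.
by rewrite (IHr _ _ E2) andbT; apply/eqP; lia.
Qed.

Lemma tshiftE N (n : 'cV[int]_N) (j : 'I_N) :
  tshift n j 0 = \sum_(k < N) n k 0 * (minn j.+1 k.+1)%:Z.
Proof. by rewrite /tshift summxE; apply: eq_bigr => k _; rewrite !mxE. Qed.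

Lemma tshiftD N (n n' : 'cV[int]_N) : tshift (n + n') = tshift n + tshift n'.
Proof.
by rewrite /tshift -big_split; apply: eq_bigr => k _; rewrite mxE scalerDl.
Qed.

(** Differencing twice inverts the matrix of the [min(j, k)] over the integers: [u] takes
    differences of [w], starting from 0, and the preimage takes differences of [u], ending in 0. *)
Lemma tshift_surj N (w : 'cV[int]_N) : exists n, tshift n = w.
Proof.
pose W (l : nat) : int := if insub l is Some i then w i 0 else 0.
pose u (l : nat) : int := if (l < N)%N then W l - (if l is l'.+1 then W l' else 0) else 0.
have uN : u N = 0 by rewrite /u ltnn.
exists (\col_k (u k - u k.+1)); apply/colP => j; rewrite tshiftE.
have -> : \sum_(k < N) (\col_k (u k - u k.+1)) k 0 * (minn j.+1 k.+1)%:Z =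
    \sum_(k < N) (minn j.+1 k.+1)%:Z * (u k - u k.+1).
  by apply: eq_bigr => k _; rewrite mxE mulrC.
rewrite -(sum_min_diff uN) //.
have sumu (l : nat) : (l < N)%N -> \sum_(i < l.+1) u i = W l.
  elim: l => [|l IHl] lt; first by rewrite big_ord1 /u lt subr0.
  by rewrite big_ord_recr /= IHl 1?ltnW // /u lt addrC subrK.
rewrite sumu // /W; case: insubP => [i _ /ord_inj -> //|].
by rewrite ltn_ord.
Qed.

Section Torus.
Variables (L N : nat) (m alpha : nat -> nat).
Hypothesis m_pos : forall j, (1 <= j <= N)%N -> (0 < m j)%N.
Hypothesis alpha_dvd : forall j, (1 <= j <= N)%N ->
  [/\ (0 < alpha j)%N, (alpha j %| m j)%N & ((alpha j)%:Z %| vac L N m j)%Z].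
Variable K : nat -> int -> int.
Hypothesis K_sym : forall j, (1 <= j <= N)%N ->
  Jbar_alpha (m j)%:Z (vac L N m j) (alpha j) (K j.-1).
Let F := Fmat L N m alpha.

Definition shiftby (w : 'cV[int]_N) (j : nat) (i : int) : int :=
  K j i + (if insub j is Some k then w k 0 else 0).

Lemma shiftbyE w (j : 'I_N) i : shiftby w j i = K j i + w j 0.
Proof. by rewrite /shiftby valK. Qed.

Lemma Fmat_mul (v : 'cV[int]_N) (j : 'I_N) : (F *m v) j 0 =
  v j 0 * (vac L N m j.+1 %/ (alpha j.+1)%:Z)%Z +
  2 * \sum_(k < N) (minn j.+1 k.+1)%:Z * (v k 0 * (m k.+1 %/ alpha k.+1)%N%:Z).
Proof.
have E k : F j k * v k 0 =
    (if k == j then v j 0 * (vac L N m j.+1 %/ (alpha j.+1)%:Z)%Z else 0) +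
    2 * ((minn j.+1 k.+1)%:Z * (v k 0 * (m k.+1 %/ alpha k.+1)%N%:Z)).
  have [a0 am aq] := @alpha_dvd k.+1 (ltn_ord k); rewrite /F mxE.
  have Em : 2 * (minn j.+1 k.+1 * m k.+1)%N%:Z =
      (2 * (minn j.+1 k.+1)%:Z * (m k.+1 %/ alpha k.+1)%N%:Z) * (alpha k.+1)%:Z.
    by rewrite -{1}(divnK am) !PoszM !mulrA.
  have a0' : (alpha k.+1)%:Z != 0 :> int by rewrite -lt0n in a0 *; lia.
  rewrite Em divzDr ?dvdz_mull // mulzK //.
  rewrite mulrDl; congr (_ + _).
    by rewrite eq_sym; case: eqP => [->|_]; rewrite ?div0z ?mul0r // mulrC.
  lia.
rewrite mxE (eq_bigr _ (fun k _ => E k)) big_split -big_mkcond big_pred1_eq /=.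
by rewrite mulr_sumr.
Qed.

Lemma K_translation (j : 'I_N) (s c : int) :
  (forall i, K j (i + s) = K j i + c) <->
  exists v : int, s = v * (m j.+1 %/ alpha j.+1)%N%:Z /\
                  c = v * (vac L N m j.+1 %/ (alpha j.+1)%:Z)%Z.
Proof.
have jN : (1 <= j.+1 <= N)%N := ltn_ord j.
have [a0 am aq] := alpha_dvd jN.
exact: symmetry_generator (m_pos jN) a0 am aq (K_sym jN) s c.
Qed.

(** Equal paths have riggings related by a [slide]. By symmetry its index shift at level [j] is a
    multiple [v j] of the quotient of [m] by [alpha], with displacement [v j] times the vacancy part
    of [F]; the sum of the [s l], rewritten through these shifts, yields the part with [min].
    Conversely [v] prescribes the shifts, whose tail sums form the slide. *)
Lemma shiftby_angle (w w' : 'cV[int]_N) p p' : (0 < N)%N ->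
  angle_of L N.-1 (shiftby w) p -> angle_of L N.-1 (shiftby w') p' ->
  p = p' <-> torus_eq F w w'.
Proof.
move=> N0 R R'; split.
  move=> E; rewrite -{p'}E in R'; have [s [sN Es]] := angle_of_slide_inv R' R.
  rewrite prednK // in sN.
  have H (j : 'I_N) : exists v : int,
      s j - s j.+1 = v * (m j.+1 %/ alpha j.+1)%N%:Z /\
      w j 0 - w' j 0 - 2 * \sum_(l < j.+1) s l = v * (vac L N m j.+1 %/ (alpha j.+1)%:Z)%Z.
    apply/K_translation => i.
    have le_j : (j <= N.-1)%N by have := ltn_ord j; lia.
    have := Es j le_j i; rewrite /slide !shiftbyE addr0 addrA.
    set S := \sum_(l < _) _; set x := K _ _; set y := K _ _; lia.
  have [v Hv] := fin_all_exists H.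
  exists (\col_j v j); apply/colP => j; rewrite Fmat_mul !mxE.
  have [_ <-] := Hv j; rewrite (sum_min_diff sN) //.
  rewrite [X in _ + 2 * X](eq_bigr (fun k : 'I_N => (minn j.+1 k.+1)%:Z * (s k - s k.+1))).
    by rewrite subrK.
  by move=> k _; rewrite mxE -(Hv k).1.
case=> v Ev.
pose rho (l : nat) : int :=
  if insub l is Some k then (v k 0 * (m (val k).+1 %/ alpha (val k).+1)%N%:Z : int) else 0.
have rhoE (k : 'I_N) : rho k = v k 0 * (m k.+1 %/ alpha k.+1)%N%:Z by rewrite /rho valK.
have [s [sN sS ss]] := sum_min_mul rho N.
apply: angle_of_unique R _; have sN' : s N.-1.+1 = 0 by rewrite prednK.
apply: angle_of_ext (angle_of_slide sN' R') => j le_j i.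
have lt : (j < N)%N by lia.
pose J := Ordinal lt; rewrite /slide -[j]/(nat_of_ord J) !shiftbyE ss // addr0.
have [_ KT] := K_translation J (rho J) (v J 0 * (vac L N m J.+1 %/ (alpha J.+1)%:Z)%Z).
have -> : i + s J - s J.+1 = i + rho J by rewrite -sS // addrA.
rewrite KT; last by exists (v J 0); rewrite rhoE.
under eq_bigr do rewrite rhoE.
have := Fmat_mul v J; rewrite -Ev !mxE.
by move/(canRL (subrK _)) => ->; rewrite !addrA [RHS]addrAC.
Qed.

End Torus.

Theorem mainTheorem10 (L N : nat) (m alpha : nat -> nat) (p : seq nat) :
  (forall j, (1 <= j <= N)%N -> (0 < m j)%N) ->
  has_symmetry L N m alpha p ->
  exists Phi : seq nat -> 'cV[int]_N,
    [/\ (forall q q', path_orbit N p q -> path_orbit N p q' ->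
           torus_eq (Fmat L N m alpha) (Phi q) (Phi q') -> q = q'),
        (forall w : 'cV[int]_N, exists q, path_orbit N p q /\
           torus_eq (Fmat L N m alpha) (Phi q) w)
      & (forall (n : 'cV[int]_N) q, path_orbit N p q ->
           torus_eq (Fmat L N m alpha) (Phi (act n q)) (Phi q + tshift n))].
Proof.
move=> m_pos [_ [alpha_dvd [d [pp [recs [Ep Pp bal [kkr [scan sizes]] sym]]]]]].
have [N0|N0] := posnP N.
  (* Without solitons the lattice is trivial, and both the orbit and the torus are points. *)
  subst N; exists (fun=> 0); split.
  - move=> q q' [n <-] [n' <-] _; congr act; exact: etrans (flatmx0 n) (esym (flatmx0 n')).
  - move=> w; exists p; split; last by exists 0; rewrite !flatmx0.
    by exists 0; rewrite /act enum_ord0.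
  - by move=> n q _; exists 0; rewrite !flatmx0.
have sz : size recs = N by have := congr1 size scan; rewrite size_scanl size_iota.
have ones := scan_ones scan.
have [|L0 srt R] := angle_of_kkr Pp bal _ kkr ones; first by rewrite sz.
rewrite sz in R.
(* The displacement [d] accounts for the power of [T_1], which moves every rigging by 1. *)
pose K j i := records_angle L recs j i + d.
have vacE j : records_vac L recs j = vac L N m j.+1.
  rewrite /records_vac /vac sz big_add1 big_mkord; congr (_ - 2 * Posz _).
  by apply: eq_bigr => k _; rewrite sizes.
have K_sym j : (1 <= j <= N)%N -> Jbar_alpha (m j)%:Z (vac L N m j) (alpha j) (K j.-1).
  case: j => [//|j] jN /=; have [[mono per] mx] := sym _ jN.
  have E i : K j i = ext (rigging recs j.+1) (m j.+1) (vac L N m j.+1) i + d.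
    rewrite /K /records_angle /rigging vacE /= sortZ_id ?sizes //.
    by apply: (all_nthP ([::], 0%N) srt); rewrite sz.
  split; first by split=> i; rewrite !E.
  by move=> a lt d1 d2 [mo pe]; apply: (mx a lt d1 d2); split=> i; rewrite -!E.
have RK (n : 'cV[int]_N) : angle_of L N.-1 (shiftby K (tshift n)) (act n p).
  have R1 : angle_of L N.-1 K p.
    rewrite Ep; apply: angle_of_ext (angle_of_Tpow 1 d L0 R) => j _ i.
    by rewrite minnSS minn0 mulr1.
  apply: angle_of_ext (angle_of_act n L0 R1) => j le_j i.
  have lt : (j < N)%N by lia.
  by rewrite (shiftbyE _ _ (Ordinal lt)) tshiftE.
have actP (n n' : 'cV[int]_N) : act n p = act n' p <-> torus_eq (Fmat L N m alpha) (tshift n) (tshift n').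
  exact: (shiftby_angle m_pos alpha_dvd K_sym N0 (RK n) (RK n')).
(* Additivity is read off the riggings: both paths have the same ones, and these determine the
   path. *)
have actD (n n' : 'cV[int]_N) : act n (act n' p) = act (n' + n) p.
  suff R2 : angle_of L N.-1 (shiftby K (tshift (n' + n))) (act n (act n' p)).
    exact: (angle_of_unique R2 (RK (n' + n))).
  apply: angle_of_ext (angle_of_act n L0 (RK n')) => j le_j i.
  have lt : (j < N)%N by lia.
  by rewrite !(shiftbyE _ _ (Ordinal lt)) tshiftD mxE (tshiftE n) addrA.
(* Chooses a lattice element carrying [p] to [q]; by [actP] its class on the torus does not depend
   on the choice. *)
pose pick q : 'cV[int]_N := epsilon (inhabits 0) (fun n => act n p = q).
have pickP q : path_orbit N p q -> act (pick q) p = q.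
  by move=> orb; apply: (epsilon_spec (inhabits 0) (fun n => act n p = q)).
exists (fun q => tshift (pick q)); split.
- by move=> q q' /pickP Eq /pickP Eq' /actP; rewrite Eq Eq'.
- move=> w; have [n <-] := tshift_surj w; exists (act n p).
  by split; [exists n | apply/actP; apply: pickP; exists n].
move=> n q /pickP Eq; rewrite -tshiftD; apply/actP.
rewrite pickP -?actD ?Eq //; exists (pick q + n); by rewrite -actD Eq.
Qed.
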